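(* Assume $\Gamma=\Omega(\max\{\sigma_{\max}^2\log(|\mathcal{X}|/\delta)\,d^2,\ d^2\})$. For any $x\in\mathcal{X}$ and $\delta\in(0,1)$, the HEAD algorithm run with budget $\Gamma$, with the resulting variance estimates $\widehat\sigma_x^2=\min\{\max\{x^\top\widehat\Sigma_\Gamma x,\sigma_{\min}^2\},\sigma_{\max}^2\}$, guarantees $$\mathbb{P}\left(|\widehat\sigma_x^2-\sigma_x^2|\le C_{\Gamma,\delta}\right)\ge 1-\delta/2,\qquad\text{where } C_{\Gamma,\delta}=\mathcal{O}\left(\sqrt{\frac{\log(|\mathcal{X}|/\delta)\,\sigma_{\max}^2\,d^2}{\Gamma}}\right).$$
   Context: Model. $\mathcal{X}\subset\mathbb{R}^d$ is finite with $\mathrm{span}(\mathcal{X})=\mathbb{R}^d$. Each pull of an arm $x\in\mathcal{X}$ yields $y=x^\top\theta^*+\eta$, where $\theta^*\in\mathbb{R}^d$ is unknown and $\eta\sim\mathcal{N}(0,\sigma_x^2)$ is independent across pulls, with $\sigma_x^2=x^\top\Sigma^*x$ for an unknown positive semidefinite $\Sigma^*\in\mathbb{R}^{d\times d}$. Known constants $\sigma_{\min}^2,\sigma_{\max}^2>0$ satisfy $\sigma_{\min}^2\le\sigma_x^2\le\sigma_{\max}^2$ for all $x\in\mathcal{X}$. Notation. $M=d(d+1)/2$; $\mathrm{vech}$ is the half-vectorization of symmetric matrices; $G\in\mathbb{R}^{d^2\times M}$ is the duplication matrix, $G\,\mathrm{vech}(A)=\mathrm{vec}(A)$ for symmetric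 $A$; $\phi_x=G^\top\mathrm{vec}(xx^\top)\in\mathbb{R}^M$, so $\phi_x^\top\mathrm{vech}(A)=x^\top Ax$ for symmetric $A$. The set $\{\phi_x:x\in\mathcal{X}\}$ spans $\mathbb{R}^M$. $P_{\mathcal{X}}$ is the set of probability distributions on $\mathcal{X}$. HEAD algorithm with budget $\Gamma$. Stage 1: let $\lambda^*\in\arg\min_{\lambda\in P_{\mathcal X}}\max_{x\in\mathcal{X}}x^\top(\sum_{x'\in\mathcal X}\lambda_{x'}x'x'^\top)^{-1}x$. Pull each arm $x$ $\lceil\lambda^*_x\Gamma/2\rceil$ times, collecting $\{x_t,y_t\}_{t=1}^{\Gamma/2}$, and compute $\widehat\theta_{\Gamma/2}=(\sum_{t=1}^{\Gamma/2}x_tx_t^\top)^{-1}\sum_{t=1}^{\Gamma/2}x_ty_t$. Stage 2: let $\lambda^\dagger\in\arg\min_{\lambda\in P_{\mathcal X}}\max_{x\in\mathcal{X}}\phi_x^\top(\sum_{x'\in\mathcal X}\lambda_{x'}\phi_{x'}\phi_{x'}^\top)^{-1}\phi_x$. Pull each arm $x$ $\lambda^\dagger_x\Gamma/2$ times, collecting $\{x_t,y_t\}_{t=\Gamma/2+1}^{\Gamma}$, and output the symmetric matrix $\widehat\Sigma_\Gamma$ with $\mathrm{vech}(\widehat\Sigma_\Gamma)=\big(\sum_{t=\Gamma/2+1}^{\Gamma}\phi_{x_t}\phi_{x_t}^\top\big)^{-1}\sum_{t=\Gamma/2+1}^{\Gamma}\phi_{x_t}(y_t-x_t^\top\widehat\theta_{\Gamma/2})^2$.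 Non-integer allocations are handled by an efficient rounding procedure: for a tolerance $\epsilon\in(0,1/3]$, the rounded allocation of $\Gamma/2$ samples has maximal quadratic form (the design criterion of that stage) at most $(1+6\epsilon)$ times the optimal value for $\Gamma/2$ samples.
   Formalization: The constant hidden in O(·) may depend on σ_max² (with a universal constant the claim fails as σ_max² grows), and 𝒳 is assumed to have at least two arms (with one arm log(|𝒳|/δ) tends to 0 as δ tends to 1 and the claim fails). *)

(* Defs.v *)
From HB Require Import structures.
From mathcomp Require Import all_boot all_order all_algebra finmap.
From mathcomp Require Import all_classical all_reals all_analysis.

Set Implicit Arguments.
Unset Strict Implicit.
Unset Printing Implicit Defensive.

Import Order.TTheory GRing.Theory Num.Theory.

Local Open Scope ring_scope.

(* The library has no independence of random variables: this is the product
   rule over every finite subfamily. *)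
Definition mutually_independent d (Omega : measurableType d) (R : realType)
    (P : probability Omega R) (I : finType) (X : I -> {RV P >-> R}) : Prop :=
  forall (J : {set I}) (B : I -> set R),
    (forall i, measurable (B i)) ->
    P (\bigcap_(i in [set` J]) X i @^-1` B i)%classic =
    (\prod_(i in J) P (X i @^-1` B i)%classic)%E.

Section HalfVectorization.
Variable d : nat.

Definition vech_dim : nat := (d * d.+1)./2.

(* Positions (i, j), j <= i, of the lower triangle, column by column. *)
Definition vech_pairs_seq : seq ('I_d * 'I_d) :=
  [seq (i, j) | j : 'I_d <- enum 'I_d,
                i : 'I_d <- [seq i : 'I_d <- enum 'I_d | (j <= i)%N]].

Lemma size_vech_pairs_seq : size vech_pairs_seq == vech_dim.
Proof.
apply/eqP; rewrite /vech_pairs_seq size_allpairs_dep.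
rewrite sumnE big_map big_enum /=.
rewrite (eq_bigr (fun j : 'I_d => (rev_ord j).+1)) => [|j _]; last first.
  rewrite size_filter -sum1_count big_enum_cond /=.
  have := @big_ord_widen_cond _ 0%N addn.
  rewrite (eq_bigl (fun i : 'I_d => (j <= i)%N)) //.
  transitivity (\sum_(0 <= i < d | (j <= i)%N) 1)%N; first by rewrite big_mkord.
  rewrite (@big_cat_nat _ _ _ j) //=; last exact: ltnW.
  rewrite big_nat_cond big_pred0 ?add0n => [|i]; last first.
    by case: (ltnP i j) => ?; rewrite ?andbF.
  rewrite big_nat_cond (eq_bigl (fun i => (j <= i < d)%N)) => [|i]; last first.
    by case: (j <= i)%N; rewrite ?andbF ?andbT.
  by rewrite -big_nat sum_nat_const_nat muln1 subnSK.
rewrite (reindex_inj rev_ord_inj).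
under eq_bigr => j _ do rewrite rev_ordK -addn1.
rewrite big_split /= sum_nat_const card_ord muln1.
have -> : (\sum_(i < d) i = 'C(d, 2))%N by rewrite -bin2_sum big_mkord.
by rewrite -[X in (_ + X)%N]bin1 -binS bin2 mulnC.
Qed.

Definition vech_pairs : vech_dim.-tuple ('I_d * 'I_d) :=
  Tuple size_vech_pairs_seq.

Variable R : realType.

Definition vech (A : 'M[R]_d) : 'cV[R]_vech_dim :=
  \col_k A (tnth vech_pairs k).1 (tnth vech_pairs k).2.

(* Columns stacked on top of each other ([mxvec] concatenates rows). *)
Definition vec (A : 'M[R]_d) : 'cV[R]_(d * d) := (mxvec A^T)^T.

(* Column k of the duplication matrix is vec of the symmetric 0/1 matrix
   supported on the k-th position of the lower triangle and its mirror image;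
   [dup_mx_vech] is the defining property. *)
Definition dup_mx : 'M[R]_(d * d, vech_dim) :=
  \matrix_(s, k)
    vec (\matrix_(i, j)
      (((i, j) == tnth vech_pairs k) || ((j, i) == tnth vech_pairs k))%:R) s 0.

(* The symmetric matrix whose half-vectorization is v. *)
Definition unvech (v : 'cV[R]_vech_dim) : 'M[R]_d :=
  (vec_mx (dup_mx *m v)^T)^T.

Definition phi (x : 'cV[R]_d) : 'cV[R]_vech_dim :=
  dup_mx^T *m vec (x *m x^T).

Definition qform (A : 'M[R]_d) (x : 'cV[R]_d) : R := (x^T *m A *m x) 0 0.

Definition psd (A : 'M[R]_d) : Prop :=
  A^T = A /\ forall x : 'cV[R]_d, 0 <= qform A x.

Lemma mem_vech_pairs (i j : 'I_d) :
  ((i, j) \in vech_pairs) = (j <= i)%N.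
Proof.
apply/allpairsPdep/idP => [[j' [i' [_ ]]]|ji].
  by rewrite mem_filter => /andP[ji _] [-> ->].
by exists j, i; rewrite mem_enum mem_filter mem_enum ji.
Qed.

Lemma uniq_vech_pairs : uniq vech_pairs.
Proof.
apply: allpairs_uniq_dep => [|j _|]; first exact: enum_uniq.
  by rewrite filter_uniq // enum_uniq.
by move=> [a b] [a' b'] _ _ /= [-> ->].
Qed.

Lemma vecE A (i j : 'I_d) : vec A (mxvec_index j i) 0 = A i j.
Proof. by rewrite mxE mxvecE mxE. Qed.

Lemma vec_mx_vec A : (vec_mx (vec A)^T)^T = A.
Proof. by rewrite /vec trmxK mxvecK trmxK. Qed.

Lemma dup_mx_row (i j : 'I_d) (k : 'I_vech_dim) : (j <= i)%N ->
  tnth vech_pairs k = (i, j) -> forall v : 'cV[R]_vech_dim,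
  (dup_mx *m v) (mxvec_index j i) 0 = v k 0 /\
  (dup_mx *m v) (mxvec_index i j) 0 = v k 0.
Proof.
move=> ji Hk v.
have key l : ((i, j) == tnth vech_pairs l) || ((j, i) == tnth vech_pairs l) =
             (l == k).
  have E : ((i, j) == tnth vech_pairs l) = (l == k).
    rewrite -Hk eq_sym; apply/eqP/eqP => [|->//].
    exact: (tuple_uniqP _ uniq_vech_pairs).
  rewrite E; case: eqP => [->|/eqP lk] //=; apply/negbTE/eqP => H.
  have := mem_tnth l vech_pairs; rewrite -H mem_vech_pairs => ij.
  have ij' : i = j by apply/val_inj/eqP; rewrite eqn_leq ij ji.
  by move: lk; rewrite -E ij' -H ij' eqxx.
rewrite !mxE; split; rewrite (bigD1 k) //= mxE vecE mxE.
- rewrite key eqxx mul1r big1 ?addr0 // => l lk.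
  by rewrite mxE vecE mxE key (negbTE lk) mul0r.
- rewrite orbC key eqxx mul1r big1 ?addr0 // => l lk.
  by rewrite mxE vecE mxE orbC key (negbTE lk) mul0r.
Qed.

Lemma vech_pairs_onto (i j : 'I_d) : (j <= i)%N ->
  exists k, tnth vech_pairs k = (i, j).
Proof. by rewrite -mem_vech_pairs => /tnthP[k ->]; exists k. Qed.

Lemma dup_mx_vech (A : 'M[R]_d) : A^T = A -> dup_mx *m vech A = vec A.
Proof.
move=> sA; apply/colP => s; case/mxvec_indexP: s => j i; rewrite vecE.
have [ji|/ltnW ij] := leqP j i.
  by have [k Hk] := vech_pairs_onto ji;
    rewrite (dup_mx_row ji Hk _).1 mxE Hk.
have [k Hk] := vech_pairs_onto ij.
by rewrite (dup_mx_row ij Hk _).2 mxE Hk /= -[in RHS]sA mxE.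
Qed.

Lemma unvechE v (i j : 'I_d) :
  unvech v i j = (dup_mx *m v) (mxvec_index j i) 0.
Proof. by rewrite /unvech mxE mxE [LHS]mxE. Qed.

Lemma unvech_sym v : (unvech v)^T = unvech v.
Proof.
apply/matrixP => i j; rewrite mxE !unvechE.
have [ji|/ltnW ij] := leqP j i.
  by have [k Hk] := vech_pairs_onto ji; have [-> ->] := dup_mx_row ji Hk v.
by have [k Hk] := vech_pairs_onto ij; have [-> ->] := dup_mx_row ij Hk v.
Qed.

Lemma vech_unvech v : vech (unvech v) = v.
Proof.
apply/colP => k; rewrite mxE unvechE.
case E: (tnth vech_pairs k) => [i j] /=.
have ji : (j <= i)%N by rewrite -mem_vech_pairs -E mem_tnth.
by have [-> _] := dup_mx_row ji E v.
Qed.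

Lemma phi_vech x (A : 'M[R]_d) : A^T = A ->
  ((phi x)^T *m vech A) 0 0 = qform A x.
Proof.
move=> sA; rewrite /phi trmx_mul (trmxK dup_mx) -mulmxA dup_mx_vech // /qform mxE.
transitivity (\sum_j \sum_i (x i 0 * x j 0) * A i j).
  rewrite (reindex (uncurry (@mxvec_index d d))) /=; last first.
    exact: (curry_mxvec_bij d d).
  rewrite (pair_big xpredT xpredT (fun j i => x i 0 * x j 0 * A i j)) /=.
  apply: eq_bigr => -[j i] _ /=; rewrite vecE mxE vecE !mxE big_ord1 mxE.
  by [].
rewrite mxE; apply: eq_bigr => j _; rewrite mxE mulr_suml.
by apply: eq_bigr => i _; rewrite !mxE mulrAC.
Qed.

End HalfVectorization.

Section Design.
Variables (R : realType) (I : finType) (n : nat) (f : I -> 'cV[R]_n).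

Definition info_mx (w : I -> R) : 'M[R]_n :=
  \sum_i w i *: (f i *m (f i)^T).

(* max_i f_i^T (sum_j w_j f_j f_j^T)^-1 f_i, with the usual convention that it
   is +oo when the matrix is singular ([invmx] is a junk value there). *)
Definition max_quad (w : I -> R) : \bar R :=
  if info_mx w \in unitmx then
    (\big[Num.max/0]_i ((f i)^T *m invmx (info_mx w) *m f i) 0 0)%:E
  else +oo%E.

Definition is_distr (w : I -> R) : Prop :=
  (forall i, 0 <= w i) /\ \sum_i w i = 1.

Definition optimal_design (lam : I -> R) : Prop :=
  is_distr lam /\
  forall mu, is_distr mu -> (max_quad lam <= max_quad mu)%E.

(* Guarantee of the rounding procedure: N samples are taken, n_i of them at i,
   and the criterion is within 1 + 6 eps of its optimal value for N samples,
   i.e. of the criterion at the fractional allocation N lam. *)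
Definition rounded_allocation (eps : R) (lam : I -> R) (N : nat)
    (c : I -> nat) : Prop :=
  (\sum_i c i)%N = N /\
  (max_quad (fun i => (c i)%:R) <=
     (1 + 6 * eps)%R%:E * max_quad (fun i => N%:R * lam i)%R)%E.

End Design.

Section Head.
Variables (R : realType) (d : nat) (X : {fset 'cV[R]_d}) (Gamma : nat).
(* Arm pulled at each time; time t (counted from 0) is in the first stage when
   t < Gamma/2. *)
Variable arm : 'I_Gamma -> X.

Definition stage1 : {set 'I_Gamma} := [set t : 'I_Gamma | (t < Gamma./2)%N].
Definition stage2 : {set 'I_Gamma} := ~: stage1.

Definition pulls (S : {set 'I_Gamma}) (x : X) : nat :=
  #|[set t in S | arm t == x]|.

(* The allocation is not adaptive, so the order of the pulls within a stage is
   left arbitrary. *)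
Definition head_pulls (eps : R) : Prop :=
  exists lam_star lam_dag : X -> R,
    [/\ optimal_design (fun x : X => val x) lam_star,
        rounded_allocation (fun x : X => val x) eps lam_star Gamma./2
          (pulls stage1),
        optimal_design (fun x : X => phi (val x)) lam_dag &
        rounded_allocation (fun x : X => phi (val x)) eps lam_dag Gamma./2
          (pulls stage2)].

Definition reward (theta : 'cV[R]_d) (eta : 'I_Gamma -> R) (t : 'I_Gamma) : R :=
  ((val (arm t))^T *m theta) 0 0 + eta t.

Definition theta_hat (y : 'I_Gamma -> R) : 'cV[R]_d :=
  invmx (\sum_(t in stage1) val (arm t) *m (val (arm t))^T) *m
  \sum_(t in stage1) y t *: val (arm t).

Definition Sigma_hat (y : 'I_Gamma -> R) : 'M[R]_d :=
  unvech (
    invmx (\sum_(t in stage2) phi (val (arm t)) *m (phi (val (arm t)))^T) *m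
    \sum_(t in stage2)
      (y t - ((val (arm t))^T *m theta_hat y) 0 0) ^+ 2 *: phi (val (arm t))).

Definition var_hat (smin2 smax2 : R) (y : 'I_Gamma -> R) (x : 'cV[R]_d) : R :=
  Num.min (Num.max (qform (Sigma_hat y) x) smin2) smax2.

End Head.

(* Main.v *)
(* Let [A1], [A2] be the Gram matrices of the arms pulled in the two stages. The
   weights [a_t = phi_x^T A2^-1 phi_(x_t)] of the second-stage least squares
   reproduce the true variance, so the estimation error is
     sum_t a_t ((eta_t - b_t)^2 - sigma_t^2),
   where [b_t = x_t^T (theta_hat - theta)] is linear in the first-stage noise.
   An exchange argument on determinants (Kiefer-Wolfowitz up to a factor 2)
   gives [A1]- and [A2]-quadratic forms at most [k = 12 d / Gamma] and
   [v = 12 d^2 / Gamma] at every arm. The square term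
   [sum a_t (eta_t^2 - sigma_t^2)] is handled by a Chernoff bound. For the cross
   term, write [A1^-1 = E E^T]: then [sum a_t eta_t b_t = sum_j h_j g_j] with
   Gaussian linear forms [h_j] (second stage) and [g_j] (first stage), and a union
   bound over the [d <= |X|] indices avoids conditioning on the first stage. The
   term [sum a_t b_t^2] only needs a union bound over the arms.
   Clipping makes the claim trivial unless [l v <= 1], where
   [l = ln (16 |X| / delta)], which is why [Gamma >= d^2] suffices. *)
Require Import Defs.
From HB Require Import structures.
From mathcomp Require Import all_boot all_order all_algebra finmap.
From mathcomp Require Import all_classical all_reals all_analysis.
From mathcomp Require Import measurable_realfun ring lra.

Set Implicit Arguments.
Unset Strict Implicit.
Unset Printing Implicit Defensive.

Import Order.TTheory GRing.Theory Num.Theory.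
Import numFieldNormedType.Exports.

Local Open Scope ring_scope.

(** * Independence and Gaussian moments *)

Section Density.
Context d1 d2 (T1 : measurableType d1) (T2 : measurableType d2) (R : realType).
Variables (mu : {measure set T1 -> \bar R}) (nu : {measure set T2 -> \bar R}).
Variables (X : T1 -> T2) (g : T1 -> R).
Hypotheses (mX : measurable_fun setT X) (mg : measurable_fun setT g).
Hypothesis g0 : forall x, 0 <= g x.
Hypothesis nuE : forall B, measurable B ->
  nu B = (\int[mu]_(x in X @^-1` B) (g x)%:E)%E.

Import HBNNSimple.
Local Open Scope classical_set_scope.
Local Open Scope ereal_scope.

(** Monotone convergence along simple functions reduces the claim to indicators, where it is [nuE].
    It serves twice: with [X] a random variable and [g] the product of the other factors, for
    independence, and with [X] the identity and [g] the normal density, for Gaussian moments. *)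
Lemma ge0_integral_density (f : T2 -> R) : measurable_fun setT f ->
  (forall y, (0 <= f y)%R) ->
  \int[nu]_y (f y)%:E = \int[mu]_x (f (X x) * g x)%:E.
Proof.
move=> mf f0.
have mfE : measurable_fun setT (EFin \o f) by exact/measurable_EFinP.
pose h := nnsfun_approx measurableT mfE.
have hf y : EFin \o h ^~ y @ \oo --> (f y)%:E.
  by apply: cvg_nnsfun_approx => // z _; rewrite lee_fin.
have mh n : measurable_fun setT (h n) by exact/measurable_funP.
have -> : \int[nu]_y (f y)%:E = lim (\int[nu]_y (EFin \o h n) y @[n --> \oo]).
  have fE y : (f y)%:E = lim ((EFin \o h n) y @[n --> \oo]).
    by apply/esym/cvg_lim => //; exact: hf.
  under eq_integral => y _ do rewrite fE.
  apply: monotone_convergence => //.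
  - by move=> n; exact/measurable_EFinP.
  - by move=> n y _ /=; rewrite lee_fin.
  - by move=> y _ a b ab; rewrite lee_fin; exact/lefP/nd_nnsfun_approx.
have -> : \int[mu]_x (f (X x) * g x)%:E =
    lim (\int[mu]_x (h n (X x) * g x)%:E @[n --> \oo]).
  have fg x : (f (X x) * g x)%:E = lim ((h n (X x) * g x)%:E @[n --> \oo]).
    apply/esym/cvg_lim => //; under eq_fun do rewrite EFinM.
    rewrite EFinM; apply: cvgeZr => //; exact: hf.
  under eq_integral => x _ do rewrite fg.
  apply: monotone_convergence => //.
  - move=> n; apply/measurable_EFinP; apply: measurable_funM => //.
    exact: measurableT_comp.
  - by move=> n x _; rewrite lee_fin mulr_ge0.
  - move=> x _ a b ab; rewrite lee_fin ler_wpM2r //.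
    exact/lefP/nd_nnsfun_approx.
have mh1 n r : measurable_fun setT (fun x => \1_(h n @^-1` [set r]) (X x) : R).
  have m1 : measurable_fun setT (\1_(h n @^-1` [set r]) : T2 -> R) by [].
  exact: measurableT_comp m1 mX.
suff suf n : \int[nu]_y (EFin \o h n) y = \int[mu]_x (h n (X x) * g x)%:E.
  by under eq_fun do rewrite suf.
transitivity (\int[nu]_y
    (\sum_(r \in range (h n)) (r * \1_(h n @^-1` [set r]) y)%:E)).
  by apply: eq_integral => y _; rewrite /= fimfunE -fsumEFin.
rewrite ge0_integral_fsum//; last 2 first.
- by move=> r; apply/measurable_EFinP; exact: measurable_funM.
- by move=> r y _; exact: nnfun_muleindic_ge0.
transitivity (\int[mu]_x
    (\sum_(r \in range (h n)) (r * \1_(h n @^-1` [set r]) (X x) * g x)%:E));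
    last first.
  apply: eq_integral => x _; rewrite /= [in RHS]fimfunE EFinM -fsumEFin//.
  rewrite ge0_mule_fsuml//; last by move=> r; exact: nnfun_muleindic_ge0.
rewrite ge0_integral_fsum//; last 2 first.
- move=> r; apply/measurable_EFinP; apply: measurable_funM => //.
  exact: measurable_funM.
- move=> r x _; rewrite EFinM mule_ge0 ?lee_fin//.
  exact: nnfun_muleindic_ge0.
apply: eq_fsbigr => r /[!inE] -[y _ <-].
under eq_integral do rewrite EFinM.
rewrite ge0_integralZl ?lee_fin //; last by apply/measurable_EFinP.
rewrite integral_indic// setIT nuE//.
under [RHS]eq_integral do rewrite -mulrA EFinM.
rewrite ge0_integralZl ?lee_fin //; last 2 first.
- by apply/measurable_EFinP; apply: measurable_funM.
- by move=> z _; rewrite lee_fin mulr_ge0.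
congr (_ * _)%E.
rewrite integral_mkcond; apply: eq_integral => x _.
rewrite patchE indicE.
have -> : (X x \in h n @^-1` [set h n y]) =
          (x \in X @^-1` (h n @^-1` [set h n y])).
  by apply/idP/idP => /set_mem ?; exact/mem_set.
by case: ifP => _; rewrite /= ?mul1r ?mul0r.
Qed.

End Density.

(** * Factorization of expectations under independence *)

Section Independence.
Context d (Omega : measurableType d) (R : realType) (P : probability Omega R).
Variables (I : finType) (X : I -> {RV P >-> R}).
Hypothesis indepX : mutually_independent X.

Local Open Scope classical_set_scope.
Local Open Scope ereal_scope.

(* The functions indexed by [J] are arbitrary and the others are indicators:
   this is the invariant of the induction on [J] that starts from the product
   rule for events. *)
Lemma expectation_prod_on (J : {set I}) (f : I -> R -> R) (m : I -> R) :
  (forall i, measurable_fun setT (f i)) ->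
  (forall i x, (0 <= f i x)%R) ->
  (forall i, \int[P]_w (f i (X i w))%:E = (m i)%:E) ->
  (forall i, i \notin J -> exists2 B, measurable B & f i = \1_B) ->
  \int[P]_w (\prod_i f i (X i w))%:E = (\prod_i m i)%:E.
Proof.
have int1 i B : measurable B -> \int[P]_w (\1_B (X i w))%:E = P (X i @^-1` B).
  move=> mB; rewrite -[X in P X]setIT -integral_indic //.
  exact: measurable_funPTI.
have [n] := ubnP #|J|; elim: n J f m => // n IH J f m + mf f0 fm fB.
have [J0|[i0 i0J]] := set_0Vmem J.
  move=> _.
  have /choice[B HB] : forall i, exists B, measurable B /\ f i = \1_B.
    by move=> i; have [|B mB fiB] := fB i; [rewrite J0 finset.in_set0 | exists B].
  have PB i : (m i)%:E = P (X i @^-1` B i).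
    by have [mB fiB] := HB i; rewrite -fm fiB int1.
  rewrite -prodEFin; under [RHS]eq_bigr do rewrite PB.
  have := indepX (finset.setTfor I) (fun i => (HB i).1).
  under [X in _ = X -> _]eq_bigl do rewrite finset.in_setT.
  move=> <-; rewrite -[X in P X]setIT -integral_indic //; last first.
    by apply: fin_bigcap_measurable => // i _; exact: measurable_funPTI (HB i).1.
  apply: eq_integral => w _; congr (_%:E); rewrite indicE.
  have [Bw|/existsNP[i Bw]] := pselect (forall i, B i (X i w)).
    rewrite mem_set; last by move=> i _; exact: Bw.
    by apply: big1 => i _; rewrite (HB i).2 indicE mem_set.
  rewrite memNset; last by move=> /(_ i); apply: contra_not Bw; apply; rewrite /= finset.in_setT.
  by rewrite (bigD1 i) //= (HB i).2 indicE memNset // mul0r.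
rewrite (cardsD1 i0) i0J => Jn; pose k := (\prod_(i | i != i0) m i)%R.
have m_ge0 i : (0 <= m i)%R.
  by rewrite -lee_fin -fm; apply: integral_ge0 => w _; rewrite lee_fin.
have k0 : (0 <= k)%R by apply: prodr_ge0.
pose G w := (\prod_(i | i != i0) f i (X i w))%R.
have mG : measurable_fun setT G.
  rewrite /G; under eq_fun do rewrite big_mkcond.
  apply: measurable_prod => i _; case: (i == i0) => //=.
  exact: measurableT_comp.
have G0 w : (0 <= G w)%R by apply: prodr_ge0.
(* [nu] is the law of [X i0] scaled by the expected product of the other factors. The induction
   hypothesis, with [f i0] replaced by an indicator, identifies it with the image under [X i0] of
   the measure of density [G]; [ge0_integral_density] then passes from the indicator to [f i0]. *)
pose nu := mscale (NngNum k0) (distribution P (X i0)).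
have nuE B : measurable B -> nu B = \int[P]_(w in X i0 @^-1` B) (G w)%:E.
  move=> mB.
  pose f' i := if i == i0 then \1_B else f i.
  pose m' i := if i == i0 then fine (P (X i0 @^-1` B)) else m i.
  have mXB : measurable (X i0 @^-1` B).
    exact: measurable_funPTI.
  transitivity ((\prod_i m' i)%:E).
    rewrite (bigD1 i0) //= /m' eqxx EFinM fineK ?fin_num_measure //.
    under eq_bigr => i /negbTE -> do [].
    by rewrite muleC.
  rewrite -(IH (J :\ i0)%SET f' m').
  - rewrite [RHS]integral_mkcond; apply: eq_integral => w _.
    rewrite patchE (bigD1 i0) //= /f' eqxx indicE.
    under eq_bigr => i /negbTE -> do [].
    have -> : (X i0 w \in B) = (w \in X i0 @^-1` B).
      by apply/idP/idP => /set_mem ?; exact/mem_set.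
    by case: ifP => _; rewrite ?mul1r ?mul0r.
  - by move: Jn; rewrite add1n ltnS.
  - by move=> i; rewrite /f'; case: ifP.
  - by move=> i x; rewrite /f'; case: ifP => // _; rewrite indicE.
  - move=> i; rewrite /f' /m'; case: eqP => [->|_]; last exact: fm.
    by rewrite int1 // fineK ?fin_num_measure.
  - move=> i; rewrite /f' !inE negb_and negbK; case: eqP => [_ _|_ /= /fB //].
    by exists B.
have := ge0_integral_density (X := X i0) _ mG G0 nuE (mf i0) (f0 i0).
rewrite ge0_integral_mscale //=; last 2 first.
- exact/measurable_EFinP.
- by move=> x _; rewrite lee_fin.
rewrite ge0_integral_distribution //=; last 2 first.
- exact/measurable_EFinP.
- by move=> x; rewrite lee_fin.
rewrite fm => H; rewrite (bigD1 i0) //= mulrC EFinM H //.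
by apply: eq_integral => w _; rewrite (bigD1 i0).
Qed.

(** The functions [g i] are left general so that one bound covers linear forms and weighted centered
    squares. *)
Lemma chernoff_sum (g : I -> R -> R) (m : I -> R) (l r : R) : (0 < l)%R ->
  (forall i, measurable_fun setT (g i)) ->
  (forall i, \int[P]_w (expR (l * g i (X i w)))%:E = (m i)%:E) ->
  P [set w | (r <= \sum_i g i (X i w))%R] <=
    (\prod_i m i * expR (- (l * r)))%:E.
Proof.
move=> l0 mg gm; pose Y w := (\sum_i g i (X i w))%R.
have mY : measurable_fun setT Y.
  by apply: measurable_sum => i; exact: measurableT_comp.
pose YP : {RV P >-> R} := HB.pack Y (isMeasurableFun.Build _ _ _ _ Y mY).
apply: le_trans (chernoff YP r l0) _.
rewrite EFinM lee_wpmul2r ?lee_fin ?expR_ge0 // /mmt_gen_fun unlock.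
rewrite -(@expectation_prod_on [set: I]%SET (fun i x => expR (l * g i x)) m) //.
- rewrite le_eqVlt; apply/orP; left; apply/eqP.
  apply: eq_integral => w _; congr (_%:E).
  by rewrite /= -expR_sum /Y mulr_suml; congr expR; apply: eq_bigr => i _; rewrite mulrC.
- move=> i; apply: measurableT_comp => //; exact: measurable_funM.
- by move=> i; rewrite finset.in_setT.
Qed.

End Independence.

(** * Moment generating functions of a Gaussian and of its square *)

Lemma integral_normal_pdfZ (R : realType) (k m s : R) : 0 <= k ->
  (\int[lebesgue_measure]_x (k * normal_pdf m s x)%:E =
   k%:E)%E.
Proof.
move=> k0; rewrite -[RHS]mule1 -[in RHS](integral_normal_pdf m s).
under eq_integral do rewrite EFinM.
apply: ge0_integralZl => //.
- by apply/measurable_EFinP; exact: measurable_normal_pdf.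
- by move=> x _; rewrite lee_fin normal_pdf_ge0.
Qed.

Section GaussianMoments.
Context d (Omega : measurableType d) (R : realType) (P : probability Omega R).
Variables (X : {RV P >-> R}) (s : R).
Hypothesis s_gt0 : 0 < s.
Hypothesis distX : forall B, measurable B -> distribution P X B = normal_prob 0 s B.

Lemma expectation_gauss (f : R -> R) : measurable_fun setT f ->
  (forall x, 0 <= f x) ->
  (\int[P]_w (f (X w))%:E =
   \int[lebesgue_measure]_x (f x * normal_pdf 0 s x)%:E)%E.
Proof.
move=> mf f0.
rewrite -[LHS](@ge0_integral_distribution _ _ _ _ _ P X (EFin \o f)); last 2 first.
- exact/measurable_EFinP.
- by move=> x; rewrite lee_fin.
apply: (@ge0_integral_density _ _ (measurableTypeR R) _ _ lebesgue_measure
  (distribution P X) (idfun : measurableTypeR R -> R)) => //.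
- by move=> _ B mB; rewrite setTI.
- exact: measurable_normal_pdf.
- exact: normal_pdf_ge0.
Qed.

(** Completing the square: the tilted density is a multiple of the normal density with mean
    [l * s ^+ 2] and the same deviation [s]. *)
Lemma gauss_mgf (l : R) :
  (\int[P]_w (expR (l * X w))%:E = (expR (l ^+ 2 * s ^+ 2 / 2))%:E)%E.
Proof.
rewrite (expectation_gauss (f := fun x => expR (l * x))); last 2 first.
- by apply: measurableT_comp => //; exact: measurable_funM.
- by move=> x; exact: expR_ge0.
rewrite -[RHS](integral_normal_pdfZ (l * s ^+ 2) s (expR_ge0 _)).
apply: eq_integral => x _; rewrite !normal_pdfE ?gt_eqF //; congr (_%:E).
rewrite /normal_fun !(mulrCA _ (normal_peak s)) -!expRD; congr (_ * expR _).
by field; rewrite gt_eqF.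
Qed.

(** With [q = 1 - 2 * u * s ^+ 2], the tilted density is [(Num.sqrt q)^-1] times the centered normal
    density of deviation [s / Num.sqrt q]. *)
Lemma gauss_sq_mgf (u : R) : 2 * u * s ^+ 2 < 1 ->
  (\int[P]_w (expR (u * X w ^+ 2))%:E =
   ((Num.sqrt (1 - 2 * u * s ^+ 2))^-1)%:E)%E.
Proof.
rewrite -subr_gt0; set q := 1 - _ => q0.
rewrite (expectation_gauss (f := fun x => expR (u * x ^+ 2))); last 2 first.
- by apply: measurableT_comp => //; apply: measurable_funM.
- by move=> x; exact: expR_ge0.
have sq0 : 0 < Num.sqrt q by rewrite sqrtr_gt0.
pose s' := s / Num.sqrt q.
have s'0 : 0 < s' by rewrite divr_gt0.
have iq0 : 0 <= (Num.sqrt q)^-1 by rewrite invr_ge0 sqrtr_ge0.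
rewrite -[RHS](integral_normal_pdfZ 0 s' iq0).
apply: eq_integral => x _; rewrite !normal_pdfE ?gt_eqF //; congr (_%:E).
have peakE t : 0 < t -> normal_peak t = (t * Num.sqrt (pi *+ 2))^-1 :> R.
  move=> t0; rewrite /normal_peak -mulrnAr sqrtrM ?sqr_ge0 //.
  by rewrite sqrtr_sqr gtr0_norm.
rewrite /normal_fun mulrCA -expRD [RHS]mulrA; congr (_ * expR _).
  rewrite !peakE // /s'; field.
  by rewrite !gt_eqF // sqrtr_gt0 pmulrn_lgt0 // pi_gt0.
rewrite /s' expr_div_n sqr_sqrtr ?ltW // /q; field.
by rewrite !gt_eqF.
Qed.

Lemma gauss_centered_sq_mgf (u : R) : 2 * u * s ^+ 2 < 1 ->
  (\int[P]_w (expR (u * (X w ^+ 2 - s ^+ 2)))%:E =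
   ((Num.sqrt (1 - 2 * u * s ^+ 2))^-1 * expR (- (u * s ^+ 2)))%:E)%E.
Proof.
move=> us; under eq_integral do rewrite mulrBr expRD EFinM.
rewrite ge0_integralZr ?lee_fin ?expR_ge0 //.
- by rewrite gauss_sq_mgf // -EFinM.
- apply/measurable_EFinP; apply: measurableT_comp => //.
  apply: measurable_funM => //; exact: measurable_funX.
Qed.

End GaussianMoments.

(** After squaring, the claim is [1 <= (1 - 2 * u) * expR (2 * u + 8 * u ^+ 2)], and
    [expR y >= 1 + y] leaves [1 + 4 * u ^+ 2 * (1 - 4 * u)]. Negative [u] is allowed, so weights of
    either sign are covered. *)
Lemma centered_sq_mgf_le (R : realType) (u : R) : 4 * u <= 1 ->
  (Num.sqrt (1 - 2 * u))^-1 * expR (- u) <= expR (4 * u ^+ 2).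
Proof.
move=> u4; have q0 : 0 < 1 - 2 * u by lra.
have sq0 : 0 < Num.sqrt (1 - 2 * u) by rewrite sqrtr_gt0.
rewrite expRN -invfM -div1r ler_pdivrMr ?mulr_gt0 ?expR_gt0 //.
rewrite -(@ler_pXn2r _ 2) ?nnegrE ?mulr_ge0 ?expR_ge0 ?(ltW sq0) // expr1n.
have -> : (expR (4 * u ^+ 2) * (Num.sqrt (1 - 2 * u) * expR u)) ^+ 2 =
    (1 - 2 * u) * expR (2 * u + 8 * u ^+ 2).
  rewrite mulrCA exprMn sqr_sqrtr ?ltW //; congr (_ * _).
  by rewrite -expRD -expRM_natl; congr expR; ring.
apply: le_trans (ler_wpM2l (ltW q0) (expR_ge1Dx _)).
have -> : (1 - 2 * u) * (1 + (2 * u + 8 * u ^+ 2)) =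
    1 + 4 * (u ^+ 2 * (1 - 4 * u)) by ring.
by rewrite lerDl mulr_ge0 // mulr_ge0 ?sqr_ge0 // subr_ge0.
Qed.

(** * Tail bounds *)

Section Tails.
Context d (Omega : measurableType d) (R : realType) (P : probability Omega R).
Variables (I : finType) (X : I -> {RV P >-> R}) (s : I -> R).
Hypothesis indepX : mutually_independent X.
Hypothesis s_gt0 : forall i, 0 < s i.
Hypothesis distX : forall i B, measurable B ->
  distribution P (X i) B = normal_prob 0 (s i) B.

Local Open Scope classical_set_scope.

Lemma tail_abs (Z : Omega -> R) (r p : R) : measurable_fun setT Z ->
  (P [set w | (r <= Z w)%R] <= p%:E)%E -> (P [set w | (r <= - Z w)%R] <= p%:E)%E ->
  (P [set w | (r <= `|Z w|)%R] <= (2 * p)%:E)%E.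
Proof.
move=> mZ p1 p2.
have m1 : measurable [set w | r <= Z w].
  by rewrite -[X in measurable X]setTI; exact: measurable_fun_le.
have m2 : measurable [set w | r <= - Z w].
  rewrite -[X in measurable X]setTI; apply: measurable_fun_le => //.
  exact: measurableT_comp.
rewrite (_ : [set w | r <= `|Z w|] = [set w | r <= Z w] `|` [set w | r <= - Z w]).
  by rewrite mulr_natl mulr2n EFinD (le_trans (measureU2 _ _ _)) // leeD.
by apply/seteqP; split => w /=; rewrite real_ler_normr ?num_real //; [move/orP|move=> h; apply/orP].
Qed.

Lemma linear_tail1 (c : I -> R) (W l : R) : 0 < W -> 0 < l ->
  \sum_i c i ^+ 2 * s i ^+ 2 <= W ->
  (P [set w | (Num.sqrt (2 * W * l) <= \sum_i c i * X i w)%R] <= (expR (- l))%:E)%E.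
Proof.
(* The minimizer of [t ^+ 2 * W / 2 - t * r] at [r = Num.sqrt (2 * W * l)]; the minimum is [- l]. *)
move=> W0 l0 cW; pose t := Num.sqrt (2 * l / W).
have t0 : 0 < t by rewrite sqrtr_gt0 divr_gt0 // mulr_gt0.
apply: le_trans (@chernoff_sum _ _ _ P _ X indepX (fun i x => c i * x)
  (fun i => expR ((t * c i) ^+ 2 * s i ^+ 2 / 2)) t _ t0 _ _) _.
- by move=> i; apply: measurable_funM.
- move=> i; under eq_integral do rewrite mulrA.
  exact: gauss_mgf (s_gt0 i) (distX i) _.
rewrite lee_fin -expR_sum -expRD ler_expR.
have -> : \sum_i (t * c i) ^+ 2 * s i ^+ 2 / 2 =
    t ^+ 2 / 2 * \sum_i c i ^+ 2 * s i ^+ 2.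
  by rewrite mulr_sumr; apply: eq_bigr => i _; field.
have t2 : t ^+ 2 = 2 * l / W by rewrite sqr_sqrtr // divr_ge0 ?mulr_ge0 ?(ltW l0) ?(ltW W0).
have -> : t * Num.sqrt (2 * W * l) = 2 * l.
  rewrite -sqrtrM ?divr_ge0 ?mulr_ge0 ?(ltW l0) ?(ltW W0) //.
  rewrite (_ : 2 * l / W * (2 * W * l) = (2 * l) ^+ 2); last by field; rewrite gt_eqF.
  by rewrite sqrtr_sqr gtr0_norm // mulr_gt0.
rewrite t2 (_ : - l = l - 2 * l); last by ring.
rewrite lerD2r (_ : 2 * l / W / 2 = l / W); last by field; rewrite gt_eqF.
by rewrite mulrAC ler_pdivrMr // ler_wpM2l // ltW.
Qed.

Lemma linear_tail (c : I -> R) (W l : R) : 0 < W -> 0 < l ->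
  \sum_i c i ^+ 2 * s i ^+ 2 <= W ->
  (P [set w | (Num.sqrt (2 * W * l) <= `|\sum_i c i * X i w|)%R] <=
    (2 * expR (- l))%:E)%E.
Proof.
move=> W0 l0 cW; apply: tail_abs.
- by apply: measurable_sum => i; exact: measurable_funM.
- exact: linear_tail1.
- under eq_set => w.
    rewrite -sumrN; under eq_bigr do rewrite -mulNr.
    over.
  apply: (@linear_tail1 (fun i => - c i)) => //.
  by under eq_bigr do rewrite sqrrN.
Qed.

(** A Bernstein-type bound restricted to its Gaussian regime by [l * v <= 1]. The same [v] bounds
    the sum of squares and the maximum of the weights because both are controlled by the leverages
    of the design. *)
Lemma quadratic_tail1 (a : I -> R) (S v l : R) :
  0 < S -> (forall i, s i ^+ 2 <= S) ->
  0 < v -> \sum_i a i ^+ 2 <= v -> (forall i, `|a i| <= v) ->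
  0 < l -> l * v <= 1 ->
  (P [set w | (5 * S * Num.sqrt (l * v) <=
              \sum_i a i * (X i w ^+ 2 - s i ^+ 2))%R] <= (expR (- l))%:E)%E.
Proof.
move=> S0 sS v0 a2v av l0 lv1.
(* Chosen so that [4 * S * (t * v) = Num.sqrt (l * v) <= 1], which is the condition of
   [centered_sq_mgf_le] for every [u = t * a i * s i ^+ 2]. *)
pose t := Num.sqrt (l / v) / (4 * S).
have lv0 : 0 < l / v by rewrite divr_gt0.
have t0 : 0 < t by rewrite divr_gt0 ?sqrtr_gt0 // mulr_gt0.
have tv : 4 * S * (t * v) = Num.sqrt (l * v).
  rewrite [LHS](_ : _ = Num.sqrt (l / v) * v); last by rewrite /t; field; rewrite gt_eqF.
  rewrite -[X in _ * X = _](gtr0_norm v0) -sqrtr_sqr -sqrtrM ?(ltW lv0) //.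
  by congr Num.sqrt; field; rewrite gt_eqF.
have tv1 : 4 * S * (t * v) <= 1 by rewrite tv -[leRHS]sqrtr1 ler_sqrt.
have u1 i : 4 * (t * a i * s i ^+ 2) <= 1.
  apply: le_trans tv1.
  have -> : 4 * (t * a i * s i ^+ 2) = 4 * t * (s i ^+ 2 * a i) by ring.
  have -> : 4 * S * (t * v) = 4 * t * (S * v) by ring.
  apply: ler_wpM2l; first by rewrite mulr_ge0 // ltW.
  apply: (@le_trans _ _ (s i ^+ 2 * v)); last exact: (ler_wpM2r (ltW v0)).
  by apply: ler_wpM2l; [exact: sqr_ge0 | exact: le_trans (ler_norm _) (av i)].
apply: le_trans (@chernoff_sum _ _ _ P _ X indepX
  (fun i x => a i * (x ^+ 2 - s i ^+ 2))
  (fun i => (Num.sqrt (1 - 2 * (t * a i) * s i ^+ 2))^-1 *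
            expR (- (t * a i * s i ^+ 2))) t _ t0 _ _) _.
- move=> i; apply: measurable_funM => //; apply: measurable_funB => //.
- move=> i; under eq_integral do rewrite mulrA.
  apply: gauss_centered_sq_mgf (s_gt0 i) (distX i) _ _.
  by move: (u1 i); lra.
rewrite lee_fin.
apply: (@le_trans _ _ ((\prod_i expR (4 * (t * a i * s i ^+ 2) ^+ 2)) *
    expR (- (t * (5 * S * Num.sqrt (l * v)))))).
  rewrite ler_wpM2r ?expR_ge0 //; apply: ler_prod => i _.
  rewrite mulr_ge0 ?invr_ge0 ?sqrtr_ge0 ?expR_ge0 //=.
  by rewrite -(mulrA 2) centered_sq_mgf_le.
rewrite -expR_sum -expRD ler_expR.
have t2v : (4 * S * t) ^+ 2 * v = l.
  rewrite (_ : 4 * S * t = Num.sqrt (l / v)); last first.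
    by rewrite /t; field; rewrite gt_eqF.
  rewrite sqr_sqrtr ?(ltW lv0) //.
  by field; rewrite gt_eqF.
have -> : t * (5 * S * Num.sqrt (l * v)) = 5 / 4 * l.
  by rewrite -tv -[in RHS]t2v; field.
(* The exponent is then at most [l / 4 - 5 / 4 * l = - l], which is where the 5 of the threshold
   comes from. *)
suff : \sum_i 4 * (t * a i * s i ^+ 2) ^+ 2 <= l / 4 by lra.
apply: (@le_trans _ _ (\sum_i 4 * t ^+ 2 * S ^+ 2 * a i ^+ 2)).
  apply: ler_sum => i _.
  rewrite (_ : 4 * _ = 4 * t ^+ 2 * a i ^+ 2 * (s i ^+ 2) ^+ 2); last by ring.
  rewrite [leRHS]mulrAC; apply: ler_wpM2l; first by rewrite mulr_ge0 ?sqr_ge0 // mulr_ge0 ?sqr_ge0.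
  by rewrite ler_pXn2r ?nnegrE ?sqr_ge0 ?(ltW S0).
rewrite -mulr_sumr -t2v.
rewrite (_ : (4 * S * t) ^+ 2 * v / 4 = 4 * t ^+ 2 * S ^+ 2 * v); last by field.
by apply: ler_wpM2l; rewrite // mulr_ge0 ?sqr_ge0 // mulr_ge0 ?sqr_ge0.
Qed.

Lemma quadratic_tail (a : I -> R) (S v l : R) :
  0 < S -> (forall i, s i ^+ 2 <= S) ->
  0 < v -> \sum_i a i ^+ 2 <= v -> (forall i, `|a i| <= v) ->
  0 < l -> l * v <= 1 ->
  (P [set w | (5 * S * Num.sqrt (l * v) <=
              `|\sum_i a i * (X i w ^+ 2 - s i ^+ 2)|)%R] <=
    (2 * expR (- l))%:E)%E.
Proof.
move=> S0 sS v0 a2v av l0 lv1; apply: tail_abs.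
- apply: measurable_sum => i; apply: measurable_funM => //.
  by apply: measurable_funB => //; exact: measurable_funX.
- exact: quadratic_tail1.
- under eq_set => w.
    rewrite -sumrN; under eq_bigr do rewrite -mulNr.
    over.
  apply: (@quadratic_tail1 (fun i => - a i)) => //.
    by under eq_bigr do rewrite sqrrN.
  by move=> i; rewrite normrN.
Qed.

Lemma union_bound (J : finType) (A : J -> set Omega) (G : set Omega) (p : R) :
  (forall j, measurable (A j)) -> measurable G ->
  (forall j, (P (A j) <= p%:E)%E) ->
  (forall w, (forall j, ~ A j w) -> G w) ->
  ((1 - #|J|%:R * p)%:E <= P G)%E.
Proof.
move=> mA mG PA AG.
have : (P (~` G) <= \sum_j P (A j))%E.
  apply: le_trans (content_sub_fsum P (D := [set: J]) (A_ := A) _ _ _ _) _ => //.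
  - exact: finite_finset.
  - exact: measurableC.
  - move=> w Gw; apply: contrapT => Aw; apply: Gw; apply: AG => j Ajw.
    by apply: Aw; exists j.
  - rewrite [leRHS](fsbig_seq _ _ (index_enum_uniq J)).
    rewrite (_ : [set` index_enum J] = setT) //.
    by apply/seteqP; split => // j _ /=; rewrite mem_index_enum.
rewrite probability_setC // => PG.
have : (1 - P G <= (#|J|%:R * p)%:E)%E.
  apply: le_trans PG _; apply: le_trans (lee_sum _ (fun j _ => PA j)) _.
  by rewrite sumEFin sumr_const mulr_natl.
have : P G \is a fin_num by exact: fin_num_measure.
case: (P G) => //= g _; rewrite -EFinB !lee_fin; lra.
Qed.

End Tails.

(** * Gram matrices *)

Section BilinearForms.
Variable R : comPzRingType.

Definition dot n (u v : 'cV[R]_n) : R := (u^T *m v) 0 0.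

Definition bform n (A : 'M[R]_n) (u v : 'cV[R]_n) : R := dot u (A *m v).

Lemma dotC n (u v : 'cV[R]_n) : dot u v = dot v u.
Proof. by rewrite /dot -[in LHS](trmxK v) -trmx_mul mxE. Qed.

Lemma dotDr n (u v w : 'cV[R]_n) : dot u (v + w) = dot u v + dot u w.
Proof. by rewrite /dot mulmxDr mxE. Qed.

Lemma dotNr n (u v : 'cV[R]_n) : dot u (- v) = - dot u v.
Proof. by rewrite /dot mulmxN mxE. Qed.

Lemma dotBr n (u v w : 'cV[R]_n) : dot u (v - w) = dot u v - dot u w.
Proof. by rewrite dotDr dotNr. Qed.

Lemma dotDl n (u v w : 'cV[R]_n) : dot (u + v) w = dot u w + dot v w.
Proof. by rewrite !(dotC _ w) dotDr. Qed.

Lemma dotNl n (u v : 'cV[R]_n) : dot (- u) v = - dot u v.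
Proof. by rewrite !(dotC _ v) dotNr. Qed.

Lemma dotBl n (u v w : 'cV[R]_n) : dot (u - v) w = dot u w - dot v w.
Proof. by rewrite dotDl dotNl. Qed.

Lemma dotZr n (a : R) (u v : 'cV[R]_n) : dot u (a *: v) = a * dot u v.
Proof. by rewrite /dot -scalemxAr mxE. Qed.

Lemma dot_sumr n (T : finType) (P : pred T) (f : T -> 'cV[R]_n) u :
  dot u (\sum_(t | P t) f t) = \sum_(t | P t) dot u (f t).
Proof. by rewrite /dot mulmx_sumr summxE. Qed.

Lemma dot_mull n m (A : 'M[R]_(n, m)) u v : dot (A *m u) v = dot u (A^T *m v).
Proof. by rewrite /dot trmx_mul mulmxA. Qed.

Lemma dot_mulr n m (A : 'M[R]_(n, m)) u v : dot u (A *m v) = dot (A^T *m u) v.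
Proof. by rewrite dot_mull trmxK. Qed.

Lemma outer_mul n (f z : 'cV[R]_n) : f *m f^T *m z = dot f z *: f.
Proof.
by rewrite -mulmxA [f^T *m z]mx11_scalar mul_mx_scalar.
Qed.

Lemma bform_sym n (A : 'M[R]_n) u v : A^T = A -> bform A u v = bform A v u.
Proof. by move=> sA; rewrite /bform dot_mulr sA dotC. Qed.

(** The matrix determinant lemma: the two sides are [\det M], read off after multiplying [M] by two
    block triangular matrices of determinant one. *)
Lemma det_1D_outer n (u v : 'cV[R]_n) : \det (1%:M + u *m v^T) = 1 + dot v u.
Proof.
pose M := block_mx 1%:M (- u) v^T (1%:M : 'M[R]_1).
have E1 : M *m block_mx 1%:M u 0 1%:M = block_mx 1%:M 0 v^T (1 + dot v u)%:M.
  rewrite mulmx_block !(mul1mx, mulmx1, mulmx0, mul0mx, addr0) subrr.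
  by rewrite (mx11_scalar (v^T *m u)) -raddfD addrC.
have E2 : M *m block_mx 1%:M 0 (- v^T) 1%:M =
    block_mx (1%:M + u *m v^T) (- u) 0 1%:M.
  rewrite mulmx_block !(mul1mx, mulmx1, mulmx0, mul0mx, addr0, add0r).
  by rewrite mulmxN mulNmx opprK subrr.
have := congr1 determinant E1; have := congr1 determinant E2.
rewrite !det_mulmx !det_ublock !det_lblock !det1 !mulr1 !mul1r => -> ->.
by rewrite det_scalar1.
Qed.

End BilinearForms.

Section RankOne.
Variables (R : comUnitRingType) (n : nat).

Lemma det_addr_outer (V : 'M[R]_n) (u v : 'cV[R]_n) : V \in unitmx ->
  \det (V + u *m v^T) = \det V * (1 + bform (invmx V) v u).
Proof.
move=> uV; rewrite -det_1D_outer -det_mulmx mulmxDr mulmx1.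
by rewrite !mulmxA mulmxV // mul1mx.
Qed.

End RankOne.

Lemma schur_complement (R : fieldType) n (a : R) (b : 'rV[R]_n) (D : 'M[R]_n)
    (P := block_mx 1%:M (- a^-1 *: b) 0 1%:M : 'M[R]_(1 + n)) : a != 0 ->
  P^T *m block_mx a%:M b b^T D *m P =
  block_mx a%:M 0 0 (D - a^-1 *: (b^T *m b)).
Proof.
move=> a0; rewrite /P tr_block_mx !mulmx_block !trmx1 !trmx0.
rewrite !(mul1mx, mulmx1, mulmx0, mul0mx, addr0, add0r).
rewrite [(_ *: b)^T]linearZ /= -!scalemxAl mul_mx_scalar -scalemxAr mul_scalar_mx !scalerA.
by rewrite mulNr mulVf // !scaleN1r !addNr mul0mx add0r addrC scaleNr.
Qed.

(** Cholesky by induction on the dimension: the congruence by [P] splits off the first coordinate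
    and leaves the Schur complement, which is again symmetric and positive definite. *)
Lemma posdef_factor (R : rcfType) n (A : 'M[R]_n) : A^T = A ->
  (forall z, z != 0 -> 0 < bform A z z) ->
  exists E : 'M[R]_n, E^T *m A *m E = 1%:M.
Proof.
elim: n A => [|n IH] A sA pA; first by exists 0; apply/matrixP => -[].
pose a := A 0 0; pose b := @ursubmx R 1 n 1 n A.
pose D := @drsubmx R 1 n 1 n A.
have a0 : 0 < a.
  have := pA (delta_mx 0 0); rewrite /bform /dot trmx_delta -rowE -colE !mxE.
  apply; apply/eqP => /matrixP/(_ 0 0); rewrite !mxE eqxx => /eqP.
  by rewrite oner_eq0.
have AE : A = block_mx a%:M b b^T D :> 'M[R]_(1 + n).
  rewrite -[LHS](@submxK _ 1 n 1 n) (mx11_scalar (ulsubmx _)) !mxE.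
  congr (block_mx _%:M _ _ _); first by congr (A _ _); apply/val_inj.
  by rewrite /b -[in LHS]sA -trmx_ursub.
pose S := D - a^-1 *: (b^T *m b).
pose P : 'M[R]_(1 + n) := block_mx 1%:M (- a^-1 *: b) 0 1%:M.
have PAP : P^T *m A *m P = block_mx a%:M 0 0 S.
  by rewrite [in LHS]AE schur_complement ?gt_eqF.
have sS : S^T = S.
  have sD : D^T = D by rewrite /D trmx_drsub sA.
  by rewrite /S linearB linearZ /= trmx_mul trmxK sD.
have pS z : z != 0 -> 0 < bform S z z.
  move=> z0; pose y : 'cV[R]_(1 + n) := col_mx 0 z.
  have -> : bform S z z = bform A (P *m y) (P *m y).
    rewrite /bform dot_mull !mulmxA PAP mul_block_col /dot tr_col_mx.
    by rewrite mul_row_col !(mul0mx, mulmx0, add0r, trmx0).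
  apply: pA; apply: contra_neq z0 => /(congr1 (@dsubmx R 1 n 1)).
  by rewrite mul_block_col col_mxKd mul0mx add0r mul1mx linear0.
have [E ES] := IH S sS pS.
pose F : 'M[R]_(1 + n) := block_mx (Num.sqrt a)^-1%:M 0 0 E.
exists (P *m F).
rewrite trmx_mul !mulmxA -(mulmxA (F^T)) -(mulmxA (F^T)) PAP.
rewrite /F tr_block_mx !trmx0 mulmx_block.
rewrite !(mulmx0, mul0mx, addr0, add0r) (@mulmx_block _ 1 n 1 n 1 n).
rewrite !(mul1mx, mulmx1, mulmx0, mul0mx, addr0, add0r) ES tr_scalar_mx.
rewrite -!scalar_mxM mulrAC -invfM -expr2 sqr_sqrtr ?(ltW a0) // mulVf ?gt_eqF //.
by rewrite -scalar_mx_block.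
Qed.

(** * Leverages and least-squares weights of a Gram matrix *)

Section Gram.
Variables (R : rcfType) (n : nat) (T : finType) (P : pred T).
Variable f : T -> 'cV[R]_n.

Definition gram : 'M[R]_n := \sum_(t | P t) f t *m (f t)^T.

Lemma gram_sym : gram^T = gram.
Proof.
rewrite /gram linear_sum; apply: eq_bigr => t _ /=.
by rewrite trmx_mul trmxK.
Qed.

Lemma gram_mulr z : gram *m z = \sum_(t | P t) dot (f t) z *: f t.
Proof. by rewrite /gram mulmx_suml; apply: eq_bigr => t _; exact: outer_mul. Qed.

Lemma bform_gram u v :
  bform gram u v = \sum_(t | P t) dot (f t) u * dot (f t) v.
Proof.
rewrite /bform gram_mulr dot_sumr; apply: eq_bigr => t _.
by rewrite dotZr mulrC (dotC u).
Qed.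

(** A kernel vector [z] makes the sum of squares [bform gram z z] vanish, hence each of its
    terms. *)
Lemma gram_unitP :
  reflect (forall z, (forall t, P t -> dot (f t) z = 0) -> z = 0)
          (gram \in unitmx).
Proof.
apply: (iffP idP) => [uG z fz|fz].
  rewrite -[z](mulKmx uG) gram_mulr big1 ?mulmx0 // => t Pt.
  by rewrite fz // scale0r.
rewrite -row_free_unit -kermx_eq0; apply/negPn/negP => /rowV0Pn[v vK v0].
have vG : v *m gram = 0 by exact/sub_kermxP.
have : bform gram v^T v^T = 0.
  by rewrite /bform /dot trmxK mulmxA vG mul0mx mxE.
rewrite bform_gram => /psumr_eq0P fv0; move/negP: v0; apply.
rewrite -trmx_eq0; apply/eqP/fz => t Pt.
by apply/eqP; rewrite -sqrf_eq0 expr2 fv0 // => s _; rewrite -expr2 sqr_ge0.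
Qed.

Lemma bform_gram_ge0 z : 0 <= bform gram z z.
Proof. by rewrite bform_gram sumr_ge0 // => t _; rewrite -expr2 sqr_ge0. Qed.

Hypothesis gram_unit : gram \in unitmx.

Local Notation ginv := (invmx gram).

Lemma ginv_sym : ginv^T = ginv.
Proof. by rewrite trmx_inv gram_sym. Qed.

Lemma bform_ginvC u v : bform ginv u v = bform ginv v u.
Proof. by apply: bform_sym; exact: ginv_sym. Qed.

(** Comes from [ginv = ginv *m gram *m ginv]. At [u = v] it equates the sum of squared least-squares
    weights for [u] with the leverage of [u]. *)
Lemma bform_ginv u v : bform ginv u v =
  \sum_(t | P t) bform ginv u (f t) * bform ginv v (f t).
Proof.
have -> : bform ginv u v = bform gram (ginv *m u) (ginv *m v).
  by rewrite /bform dot_mull ginv_sym (mulKmx gram_unit).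
rewrite bform_gram; apply: eq_bigr => t _.
by rewrite !(bform_ginvC _ (f t)).
Qed.

Lemma bform_ginv_ge0 u : 0 <= bform ginv u u.
Proof. by rewrite bform_ginv sumr_ge0 // => t _; rewrite -expr2 sqr_ge0. Qed.

(** Nonnegativity of the form at [u + v] and [u - v] does the work of Cauchy-Schwarz. *)
Lemma bform_ginv_le (b : R) u v : bform ginv u u <= b -> bform ginv v v <= b ->
  `|bform ginv u v| <= b.
Proof.
move=> ub vb; have p := bform_ginv_ge0 (u + v); have m := bform_ginv_ge0 (u - v).
have vu := bform_ginvC v u.
move: p m vu ub vb; rewrite /bform mulmxDr mulmxBr !(dotDl, dotDr, dotNl, dotNr).
move=> p m vu ub vb.
by rewrite ler_norml; apply/andP; split; lra.
Qed.

(** Both sides are the trace of [ginv *m gram]. *)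
Lemma sum_bform_ginv : \sum_(t | P t) bform ginv (f t) (f t) = n%:R.
Proof.
rewrite -[RHS]mxtrace1 -(mulVmx gram_unit) [gram in X in _ = \tr X]/gram.
rewrite mulmx_sumr raddf_sum /=; apply: eq_bigr => t _.
by rewrite mulmxA mxtrace_mulC /bform /dot trace_mx11.
Qed.

(** Unbiasedness of least squares, from [ginv *m gram = 1%:M]. *)
Lemma bform_ginv_recover u v :
  \sum_(t | P t) bform ginv u (f t) * dot (f t) v = dot u v.
Proof.
rewrite -[v in RHS](mulKmx gram_unit) gram_mulr mulmx_sumr dot_sumr.
by apply: eq_bigr => t _; rewrite -scalemxAr dotZr mulrC.
Qed.

(** A whitening of the design: in the coordinates [E^T *m u] the form [ginv] becomes the standard
    inner product, which splits the cross term of the error into products of two linear forms. *)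
Lemma gram_factor : exists2 E : 'M[R]_n,
  E^T *m gram *m E = 1%:M & ginv = E *m E^T.
Proof.
have [|E EG] := posdef_factor gram_sym.
  move=> z z0; rewrite lt_def bform_gram_ge0 andbT; apply: contra_neq z0.
  rewrite bform_gram => /psumr_eq0P fz; apply: (gram_unitP gram_unit) => t Pt.
  by apply/eqP; rewrite -sqrf_eq0 expr2 fz // => s _; rewrite -expr2 sqr_ge0.
exists E => //; have EEG : E *m E^T *m gram = 1%:M.
  by rewrite -mulmxA; apply: mulmx1C.
by rewrite -[LHS]mul1mx -EEG (mulmxK gram_unit).
Qed.

Lemma det_gram_gt0 : 0 < \det gram.
Proof.
have [E EG _] := gram_factor; have := congr1 determinant EG.
rewrite !det_mulmx det_tr det1 mulrAC -expr2 => dE.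
by rewrite -(pmulr_rgt0 (x := (\det E) ^+ 2)) ?dE // lt_def sqr_ge0 andbT;
   apply: contra_eq_neq dE => ->; rewrite mul0r eq_sym oner_neq0.
Qed.

End Gram.

(** With [x = invmx V *m g] and [y = invmx U *m g], the right side minus the left is
    [dot f y * dot x f]; nonnegativity of [V] at [y - x] bounds this below by [dot f y ^+ 2]. *)
Lemma bform_inv_addr_outer_le (R : rcfType) n (V : 'M[R]_n) (f g : 'cV[R]_n) :
  V^T = V -> (forall z, 0 <= bform V z z) ->
  V \in unitmx -> V + f *m f^T \in unitmx ->
  bform (invmx (V + f *m f^T)) g g <= bform (invmx V) g g.
Proof.
move=> sV pV uV uU; set U := V + f *m f^T in uU *.
pose y := invmx U *m g; pose x := invmx V *m g.
have Vx : V *m x = g by rewrite mulKVmx.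
have Vy : V *m y = g - dot f y *: f.
  by rewrite -[g](mulKVmx uU) -/y mulmxDl outer_mul addrK.
have c2 : 0 <= dot f y * (dot x f - dot f y).
  have := pV (y - x).
  rewrite /bform mulmxBr Vy Vx addrAC subrr add0r dotNr dotZr dotBl (dotC y f).
  by rewrite -mulrN opprB.
rewrite /bform -/x -/y -subr_ge0 -dotBr -[g in dot g _]Vx dot_mull sV mulmxBr.
rewrite Vx Vy opprB addrCA subrr addr0 dotZr.
by move: c2; rewrite mulrBr subr_ge0; apply: le_trans; rewrite -expr2 sqr_ge0.
Qed.

(** * Near-optimal designs *)

Section DesignCriterion.
Variables (R : realType) (I : finType) (n : nat) (f : I -> 'cV[R]_n).

Lemma info_mxZ a (w : I -> R) :
  info_mx f (fun i => a * w i) = a *: info_mx f w.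
Proof.
by rewrite /info_mx scaler_sumr; apply: eq_bigr => i _; rewrite scalerA.
Qed.

Lemma info_mx_count (K : finType) (S : {set K}) (t : K -> I) :
  info_mx f (fun i => #|[set k in S | t k == i]|%:R) =
  gram (mem S) (f \o t).
Proof.
rewrite /info_mx /gram (partition_big t xpredT) //=.
apply: eq_bigr => i _; rewrite (eq_bigr (fun _ => f i *m (f i)^T)); last first.
  by move=> k /andP[_ /eqP ->].
rewrite sumr_const scaler_nat; congr (_ *+ _); apply: eq_card => k.
by rewrite !inE.
Qed.

(** The sign of [b] matches the default value 0 of the maximum, and the value [+oo] at singular
    matrices makes invertibility part of the bound. *)
Lemma max_quad_leP (w : I -> R) (b : R) : 0 <= b ->
  (max_quad f w <= b%:E)%E <->
  info_mx f w \in unitmx /\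
  forall i, bform (invmx (info_mx f w)) (f i) (f i) <= b.
Proof.
move=> b0; rewrite /max_quad; case: ifP => [uw|_]; last first.
  by split => [|[//]]; rewrite leye_eq.
rewrite lee_fin; split => [h|[_ h]].
  split=> // i; apply: le_trans h; rewrite /bform /dot mulmxA.
  exact: (le_bigmax _ (fun i => ((f i)^T *m invmx (info_mx f w) *m f i) 0 0)).
by apply: bigmax_le => // i _; have := h i; rewrite /bform /dot mulmxA.
Qed.

Lemma max_quad_scale_le (w : I -> R) (a b : R) : 0 < a -> 0 <= b ->
  (max_quad f w <= b%:E)%E -> (max_quad f (fun i => (a * w i)%R) <= (b / a)%:E)%E.
Proof.
move=> a0 b0 /max_quad_leP[//|uw wb].
have ua : a *: info_mx f w \in unitmx.
  by rewrite unitmxZ // unitfE gt_eqF.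
apply/max_quad_leP; first by rewrite divr_ge0 // ltW.
rewrite info_mxZ; split=> // i.
by rewrite invmxZ // /bform -scalemxAl dotZr mulrC ler_pM2r ?invr_gt0 //; exact: wb.
Qed.

End DesignCriterion.

Section NearOptimalDesign.
Variables (R : realType) (I : finType) (n : nat) (f : I -> 'cV[R]_n).
Hypothesis f_span : forall z, (forall i, dot (f i) z = 0) -> z = 0.
Hypotheses (I_gt0 : (0 < #|I|)%N) (leqnI : (n <= #|I|)%N).

(** Designs are sequences of [2 * #|I|] pulls. The sum type makes it immediate to pull every arm
    twice, an initial design with invertible Gram matrix. *)
Let K : finType := (I + I)%type.
Let V (t : {ffun K -> I}) := gram xpredT (f \o t).

(** Replacing the pull [k] by [j] multiplies the determinant by [(1 + qj) * (1 - p)], where [p] is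
    the quadratic form of [invmx U] at [f i]. Maximality makes this factor at most 1, and [p <= qi].
    Adding [f j] before removing [f i] keeps the intermediate matrix [U] invertible. *)
Lemma exchange_bound (t : {ffun K -> I}) (k : K) (j : I) :
  V t \in unitmx -> (forall t', \det (V t') <= \det (V t)) ->
  bform (invmx (V t)) (f j) (f j) <=
  bform (invmx (V t)) (f (t k)) (f (t k)) *
  (1 + bform (invmx (V t)) (f j) (f j)).
Proof.
move=> ut tmax; set i := t k; set qj := bform _ (f j) _; set qi := bform _ (f i) _.
pose U := V t + f j *m (f j)^T.
have qj0 : 0 <= qj by exact: bform_ginv_ge0.
have dV : 0 < \det (V t) by exact: det_gram_gt0.
have dU : \det U = \det (V t) * (1 + qj) by exact: det_addr_outer.
have uU : U \in unitmx by rewrite unitmxE dU unitfE mulf_neq0 ?gt_eqF //; lra.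
pose t' : {ffun K -> I} := [ffun k' => if k' == k then j else t k'].
have Vt' : V t' = U + (- f i) *m (f i)^T.
  rewrite /U /V /gram (bigD1 k) //= ffunE eqxx [in RHS](bigD1 k) //= -/i.
  rewrite mulNmx addrAC (addrC (f i *m _)) addrK addrC; congr (_ + _).
  by apply: eq_bigr => k' /negbTE k'k; rewrite ffunE k'k.
have := tmax t'; rewrite Vt' det_addr_outer // dU -mulrA.
rewrite ger_pMr // /bform mulmxN dotNr -/(bform _ _ _).
have : bform (invmx U) (f i) (f i) <= qi.
  by apply: bform_inv_addr_outer_le => //; [exact: gram_sym | exact: bform_gram_ge0].
nra.
Qed.

(* Kiefer-Wolfowitz up to a factor 2: [m = 2 #|I| >= 2 n] pulls maximizing the
   determinant satisfy [q_j <= q_i (1 + q_j)] for every pulled [i], and the sum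
   of the [q_i] over the pulls is [n]. *)
Lemma near_optimal_design :
  exists2 mu, is_distr mu & (max_quad f mu <= (2 * n%:R)%:E)%E.
Proof.
pose t0 : {ffun K -> I} := [ffun k => match k with inl i => i | inr i => i end].
pose t := [arg max_(t > t0) \det (V t)]%O.
have tmax t' : \det (V t') <= \det (V t).
  rewrite /t; case: Order.TotalTheory.arg_maxP => [//|s _ smax].
  exact: (smax t' isT).
have ut0 : V t0 \in unitmx.
  apply/gram_unitP => z fz; apply: f_span => i.
  by have := fz (inl i) isT; rewrite /= ffunE.
have ut : V t \in unitmx.
  by rewrite unitmxE unitfE gt_eqF // (lt_le_trans (det_gram_gt0 ut0) (tmax t0)).
pose m : R := #|K|%:R.
have mE : m = 2 * #|I|%:R by rewrite /m card_sum natrD; ring.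
have I0 : (0 : R) < #|I|%:R by rewrite ltr0n.
have m0 : 0 < m by rewrite mE; lra.
pose c i : R := #|[set k in [set: K] | t k == i]|%:R.
have cV : info_mx f c = V t.
  by rewrite /c info_mx_count /V /gram; apply: eq_bigl => k; exact: finset.in_setT.
exists (fun i => m^-1 * c i).
  split=> [i|]; first by rewrite mulr_ge0 ?invr_ge0 ?(ltW m0) ?ler0n.
  rewrite -mulr_sumr /c -natr_sum (_ : (\sum_i _)%N = #|K|) ?mulVf ?gt_eqF //.
  rewrite -sum1_card (partition_big t xpredT) //=; apply: eq_bigr => i _.
  by rewrite sum1dep_card; apply: eq_card => k; rewrite !inE.
have m0' : 0 < m^-1 by rewrite invr_gt0.
have n0 : (0 : R) <= n%:R by rewrite ler0n.
rewrite (_ : 2 * n%:R = 2 * n%:R / m / m^-1); last by field; rewrite gt_eqF.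
apply: max_quad_scale_le => //; first by rewrite divr_ge0 ?mulr_ge0 ?(ltW m0).
apply/max_quad_leP; first by rewrite divr_ge0 ?mulr_ge0 ?(ltW m0).
rewrite cV; split=> // j; set q := bform _ _ _.
have q0 : 0 <= q by exact: bform_ginv_ge0.
have : \sum_(k : K) q <= \sum_k bform (invmx (V t)) (f (t k)) (f (t k)) * (1 + q).
  by apply: ler_sum => k _; exact: exchange_bound.
rewrite -mulr_suml (sum_bform_ginv ut) sumr_const -/m -[_ *+ _]mulr_natl -/m => mq.
rewrite ler_pdivlMr //.
have : (n%:R : R) <= #|I|%:R by rewrite ler_nat.
(* From [m * q <= n * (1 + q)] and [n <= m / 2] follows [q * m <= 2 * n]. *)
rewrite mE in mq *; nra.
Qed.

(** The 6 is the rounding loss [1 + 6 * eps <= 3] times the factor 2 of [near_optimal_design], to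
    which the optimal [lam] is compared. *)
Lemma rounded_optimal_design (eps : R) (lam : I -> R) (N : nat) (c : I -> nat) :
  0 < eps <= 3^-1 -> (0 < N)%N ->
  optimal_design f lam -> rounded_allocation f eps lam N c ->
  info_mx f (fun i => (c i)%:R) \in unitmx /\
  forall i, bform (invmx (info_mx f (fun i => (c i)%:R))) (f i) (f i) <=
    6 * n%:R / N%:R.
Proof.
move=> /andP[eps0 eps3] N0 [_ lam_opt] [_ cq].
have [mu mu_distr mu_le] := near_optimal_design.
have N0' : (0 : R) < N%:R by rewrite ltr0n.
have n0 : (0 : R) <= n%:R by rewrite ler0n.
have lam_le := max_quad_scale_le N0' (mulr_ge0 (ler0n _ 2) n0)
  (le_trans (lam_opt mu mu_distr) mu_le).
apply/max_quad_leP; first by rewrite divr_ge0 ?mulr_ge0 ?(ltW N0').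
apply: le_trans cq _; apply: (@le_trans _ _
  ((1 + 6 * eps)%:E * (2 * n%:R / N%:R)%:E)%E).
  by apply: lee_wpmul2l => //; rewrite lee_fin; lra.
rewrite -EFinM lee_fin.
rewrite (_ : 6 * n%:R / N%:R = 3 * (2 * n%:R / N%:R)); last first.
  by field; rewrite gt_eqF.
by apply: ler_wpM2r; [rewrite divr_ge0 ?mulr_ge0 ?(ltW N0') | lra].
Qed.

End NearOptimalDesign.

(** * The two-stage estimator *)

Lemma dot_span_eq0 (R : realFieldType) n (xs : seq 'cV[R]_n) (z : 'cV[R]_n) :
  (<<xs>> = fullv)%VS -> (forall x, x \in xs -> dot x z = 0) -> z = 0.
Proof.
move=> sT sz; apply/matrixP => i j; rewrite [j]ord1 mxE.
have : delta_mx i 0 \in <<in_tuple xs>>%VS by rewrite /= sT memvf.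
move=> /coord_span E.
transitivity (dot (delta_mx i 0) z).
  by rewrite /dot trmx_delta -rowE mxE.
rewrite E dotC dot_sumr big1 // => k _.
by rewrite dotZr dotC sz ?mulr0 // mem_nth.
Qed.

Lemma size_span_col (R : fieldType) n (xs : seq 'cV[R]_n) :
  (<<xs>> = fullv)%VS -> (n <= size xs)%N.
Proof. by move=> sT; have := dim_span xs; rewrite sT dimvf /dim /= muln1. Qed.

Lemma vech_dim_le d : (vech_dim d <= d ^ 2)%N.
Proof.
rewrite /vech_dim; case: d => // d; rewrite -[leqRHS]doubleK half_leq //.
by rewrite -muln2 expnS expn1 -mulnA leq_mul2l orbC muln2 -addnn addSn addnS !ltnS leq_addl.
Qed.

Section HeadError.
Variables (R : realType) (d : nat) (X : {fset 'cV[R]_d}) (Gamma : nat).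
Variables (arm : 'I_Gamma -> X) (theta : 'cV[R]_d) (Sigma : 'M[R]_d).
Hypothesis Sigma_sym : Sigma^T = Sigma.

Let x_ t : 'cV[R]_d := val (arm t).
Let A1 := gram (mem (stage1 Gamma)) x_.
Let A2 := gram (mem (stage2 Gamma)) (@phi d R \o x_).
Hypotheses (u1 : A1 \in unitmx) (u2 : A2 \in unitmx).

Definition theta_error (eta : 'I_Gamma -> R) : 'cV[R]_d :=
  invmx A1 *m \sum_(t in stage1 Gamma) eta t *: x_ t.

Lemma theta_hatE eta :
  theta_hat arm (reward arm theta eta) = theta + theta_error eta.
Proof.
rewrite /theta_hat -[theta in RHS](mulKmx u1) gram_mulr -mulmxDr.
congr (_ *m _); rewrite -big_split /=; apply: eq_bigr => t _.
by rewrite -scalerDl.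
Qed.

Lemma head_error eta (x : 'cV[R]_d) :
  qform (Sigma_hat arm (reward arm theta eta)) x - qform Sigma x =
  \sum_(t in stage2 Gamma) bform (invmx A2) (phi x) (phi (x_ t)) *
    ((eta t - dot (x_ t) (theta_error eta)) ^+ 2 - qform Sigma (x_ t)).
Proof.
rewrite -!phi_vech ?unvech_sym // /Sigma_hat vech_unvech.
rewrite -!/(dot _ _) -(bform_ginv_recover u2 (phi x) (vech Sigma)).
rewrite mulmx_sumr dot_sumr -sumrB; apply: eq_bigr => t _.
rewrite -scalemxAr dotZr theta_hatE mulrBr; congr (_ - _ * _); last first.
  by rewrite -phi_vech.
rewrite mulrC; congr (_ * _ ^+ 2).
by rewrite /reward -!/(dot _ _) dotDr opprD addrACA subrr add0r.
Qed.

End HeadError.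

Lemma clip_dist (R : realDomainType) (lo hi v q : R) : lo <= v <= hi ->
  `|Num.min (Num.max q lo) hi - v| <= `|q - v|.
Proof.
move=> /andP[lov vhi].
have nq := ler_norm (q - v); have nq' := ler_norm (v - q).
rewrite distrC in nq'.
rewrite ler_norml.
by case: (leP q lo) => ?; [case: (leP lo hi)|case: (leP q hi)] => ?; apply/andP; split; lra.
Qed.

(** Both points lie in [[0, hi]]. This settles the regime [1 < l * v], where the tail bounds do not
    apply. *)
Lemma clip_dist_le (R : realDomainType) (lo hi v q : R) : 0 <= lo -> lo <= v <= hi ->
  `|Num.min (Num.max q lo) hi - v| <= hi.
Proof.
move=> lo0 /andP[lov vhi].
rewrite ler_norml.
by case: (leP q lo) => ?; [case: (leP lo hi)|case: (leP q hi)] => ?; apply/andP; split; lra.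
Qed.

(** * Deterministic error bound on the good event *)

Section DeterministicBound.
Variables (R : realType) (T J : finType) (Q : pred T).
Variables (a eta b s2 : T -> R) (e : T -> J -> R) (g : J -> R).
Variables (S v k l m : R).
Hypotheses (S_gt0 : 0 < S) (v_gt0 : 0 < v) (k_gt0 : 0 < k) (l_gt0 : 0 < l).
Hypotheses (lv1 : l * v <= 1) (m_gt0 : 0 < m).
Hypotheses (kv : k * #|J|%:R = v) (nk : \sum_(t | Q t) k ^+ 2 <= 12 * v).
Hypothesis a2v : \sum_(t | Q t) a t ^+ 2 <= v.
Hypothesis e2k : forall t, \sum_j e t j ^+ 2 <= k.
Hypothesis bE : forall t, b t = \sum_j e t j * g j.

Let h j := \sum_(t | Q t) a t * e t j * eta t.
(** A variance proxy for [h j]. The added [v * k / #|J|] keeps it positive even if all coefficients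
    of [h j] vanish, and sums over [j] to [v * k], so the total at most doubles. *)
Let W j := S * (\sum_(t | Q t) (a t * e t j) ^+ 2 + v * k / #|J|%:R).

Hypothesis quad_le :
  `|\sum_(t | Q t) a t * (eta t ^+ 2 - s2 t)| <= 5 * S * Num.sqrt (l * v).
Hypothesis b_le : forall t, `|b t| <= Num.sqrt (2 * (S * k) * l).
Hypothesis g_le : forall j, `|g j| <= Num.sqrt (2 * S * l).
Hypothesis h_le : forall j, `|h j| <= Num.sqrt (2 * W j * l).

Let sqr_le x y : 0 <= y -> `|x| <= Num.sqrt y -> x ^+ 2 <= y :> R.
Proof.
move=> y0; rewrite -(@ler_pXn2r _ 2) ?nnegrE ?sqrtr_ge0 //.
by rewrite sqr_sqrtr // real_normK ?num_real.
Qed.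

Let J_gt0 : 0 < #|J|%:R :> R.
Proof. by rewrite -(pmulr_rgt0 _ k_gt0) kv. Qed.

Let W_ge0 j : 0 <= W j.
Proof.
apply: mulr_ge0; first exact: ltW.
by rewrite addr_ge0 ?sumr_ge0 ?divr_ge0 ?mulr_ge0 ?(ltW v_gt0) ?(ltW k_gt0)
  ?(ltW J_gt0) // => t _; rewrite sqr_ge0.
Qed.

Lemma sum_W_le : \sum_j W j <= 2 * S * (v * k).
Proof.
rewrite /W -mulr_sumr (_ : 2 * S * (v * k) = S * (2 * (v * k))); last by ring.
apply: ler_wpM2l; first exact: ltW.
rewrite big_split /=.
rewrite sumr_const -[X in _ + X <= _]mulr_natr divfK ?gt_eqF // mulr_natl mulr2n.
rewrite lerD2r exchange_big /=.
apply: (@le_trans _ _ (\sum_(t | Q t) a t ^+ 2 * k)).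
  apply: ler_sum => t _; under eq_bigr do rewrite exprMn.
  by rewrite -mulr_sumr ler_wpM2l ?sqr_ge0.
by rewrite -mulr_suml ler_wpM2r // ltW.
Qed.

Lemma cross_le : `|\sum_j h j * g j| <= 3 * S * l * v.
Proof.
(* AM-GM: [2 |h g| <= h^2 / al + al g^2] *)
pose al := v / #|J|%:R.
have al0 : 0 < al by rewrite divr_gt0.
have amgm j : `|h j * g j| <= l / al * W j + S * l * al.
  have h2 := sqr_le (mulr_ge0 (mulr_ge0 (ler0n _ 2) (W_ge0 j)) (ltW l_gt0)) (h_le j).
  have g2 := sqr_le (mulr_ge0 (mulr_ge0 (ler0n _ 2) (ltW S_gt0)) (ltW l_gt0)) (g_le j).
  have : 2 * `|h j * g j| <= al^-1 * h j ^+ 2 + al * g j ^+ 2.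
    rewrite normrM -[h j ^+ 2]real_normK ?num_real // -[g j ^+ 2]real_normK ?num_real //.
    rewrite -subr_ge0 (_ : _ - _ = al^-1 * (`|h j| - al * `|g j|) ^+ 2).
      by rewrite mulr_ge0 ?sqr_ge0 // invr_ge0 ltW.
    by field; rewrite gt_eqF.
  have : al^-1 * h j ^+ 2 <= al^-1 * (2 * W j * l).
    by rewrite ler_wpM2l // invr_ge0 ltW.
  have : al * g j ^+ 2 <= al * (2 * S * l) by rewrite ler_wpM2l // ltW.
  rewrite (_ : l / al * W j = al^-1 * (2 * W j * l) / 2); last by field; rewrite gt_eqF.
  by lra.
apply: le_trans (ler_norm_sum _ _ _) _.
apply: le_trans (ler_sum _ (fun j _ => amgm j)) _.
rewrite big_split /= -mulr_sumr sumr_const -[X in _ + X <= _]mulr_natr.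
apply: (@le_trans _ _ (l / al * (2 * S * (v * k)) + S * l * al * #|J|%:R)).
  by rewrite lerD2r ler_wpM2l ?sum_W_le // divr_ge0 // ltW.
(* Since [k * #|J| = v], the first summand is [2 * S * l * v]; the second is [S * l * v]. *)
rewrite le_eqVlt; apply/orP; left; apply/eqP.
rewrite /al -kv; field.
by rewrite !gt_eqF.
Qed.

(** Uses [b t ^+ 2 <= 2 * S * k * l] and [2 * |a t| * k <= a t ^+ 2 + k ^+ 2]; the 13 is [1 + 12],
    from [a2v] and [nk]. *)
Lemma square_le : `|\sum_(t | Q t) a t * b t ^+ 2| <= 13 * S * l * v.
Proof.
apply: le_trans (ler_norm_sum _ _ _) _.
apply: (@le_trans _ _ (\sum_(t | Q t) S * l * (a t ^+ 2 + k ^+ 2))).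
  apply: ler_sum => t _.
  have b2 := sqr_le (mulr_ge0 (mulr_ge0 (ler0n _ 2) (mulr_ge0 (ltW S_gt0) (ltW k_gt0)))
    (ltW l_gt0)) (b_le t).
  rewrite normrM [X in _ * X]ger0_norm ?sqr_ge0 //.
  apply: le_trans (ler_wpM2l (normr_ge0 _) b2) _.
  rewrite [leLHS](_ : _ = S * l * (2 * `|a t| * k)); last by ring.
  apply: ler_wpM2l; first by rewrite mulr_ge0 // ltW.
  rewrite -[a t ^+ 2]real_normK ?num_real //.
  by rewrite -subr_ge0 (_ : _ - _ = (`|a t| - k) ^+ 2) ?sqr_ge0 //; ring.
rewrite -mulr_sumr big_split /= (_ : 13 * S * l * v = S * l * (13 * v)); last by ring.
apply: ler_wpM2l; first by rewrite mulr_ge0 // ltW.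
by apply: le_trans (lerD a2v nk) _; lra.
Qed.

Lemma error_le :
  `|\sum_(t | Q t) a t * ((eta t - b t) ^+ 2 - s2 t)| <=
    24 * S * Num.sqrt (l * v).
Proof.
have cross : \sum_(t | Q t) a t * eta t * b t = \sum_j h j * g j.
  rewrite /h; under [RHS]eq_bigr do rewrite mulr_suml.
  rewrite exchange_big /=; apply: eq_bigr => t _.
  by rewrite bE mulr_sumr; apply: eq_bigr => j _; ring.
have -> : \sum_(t | Q t) a t * ((eta t - b t) ^+ 2 - s2 t) =
    \sum_(t | Q t) a t * (eta t ^+ 2 - s2 t) - 2 * (\sum_j h j * g j) +
    \sum_(t | Q t) a t * b t ^+ 2.
  rewrite -cross mulr_sumr -sumrB -big_split /=.
  by apply: eq_bigr => t _; ring.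
(* As [l * v <= 1], the cross and square terms are absorbed in the square-root rate, with
   [24 = 5 + 2 * 3 + 13]. *)
have lv_le : l * v <= Num.sqrt (l * v).
  have lv0 : 0 <= l * v by rewrite mulr_ge0 ?ltW.
  rewrite -[leLHS]sqr_sqrtr // expr2 ler_piMr ?sqrtr_ge0 //.
  by rewrite -[leRHS]sqrtr1 ler_sqrt.
have : S * (l * v) <= S * Num.sqrt (l * v) by rewrite ler_wpM2l // ltW.
move: quad_le cross_le square_le; rewrite !ler_norml.
move=> /andP[? ?] /andP[? ?] /andP[? ?] ?; apply/andP; split; lra.
Qed.

End DeterministicBound.

(** * Probability of the good event *)

Section HeadConcentration.
Variables (R : realType) (d : nat) (X : {fset 'cV[R]_d}) (Gamma : nat).
Variables (arm : 'I_Gamma -> X) (theta : 'cV[R]_d) (Sigma : 'M[R]_d).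
Hypothesis Sigma_sym : Sigma^T = Sigma.

Let x_ t : 'cV[R]_d := val (arm t).
Let A1 := gram (mem (stage1 Gamma)) x_.
Let A2 := gram (mem (stage2 Gamma)) (@phi d R \o x_).
Hypotheses (u1 : A1 \in unitmx) (u2 : A2 \in unitmx).

Context disp (Omega : measurableType disp) (P : probability Omega R).
Variable eta : 'I_Gamma -> {RV P >-> R}.
Hypothesis eta_indep : mutually_independent eta.
Hypothesis eta_normal : forall (t : 'I_Gamma) (B : set R), measurable B ->
  distribution P (eta t) B = normal_prob 0 (Num.sqrt (qform Sigma (x_ t))) B.

Variables (S v k l smin2 : R).
Hypotheses (S_gt0 : 0 < S) (v_gt0 : 0 < v) (k_gt0 : 0 < k) (l_gt0 : 0 < l).
Hypothesis smin2_gt0 : 0 < smin2.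
Hypothesis var_range : forall x : X, smin2 <= qform Sigma (val x) <= S.
Hypothesis A1_le : forall x : X, bform (invmx A1) (val x) (val x) <= k.
Hypothesis A2_le : forall x : X, bform (invmx A2) (phi (val x)) (phi (val x)) <= v.
Hypotheses (kv : k * d%:R = v) (nk : \sum_(t in stage2 Gamma) k ^+ 2 <= 12 * v).
Hypothesis lv1 : l * v <= 1.

Lemma dot_theta_error y x :
  dot x (theta_error arm y) =
  \sum_t (if t \in stage1 Gamma then bform (invmx A1) x (x_ t) else 0) * y t.
Proof.
rewrite /theta_error mulmx_sumr dot_sumr big_mkcond; apply: eq_bigr => t _.
by case: ifP => _; rewrite ?mul0r // -scalemxAr dotZr mulrC.
Qed.

Let s2_gt0 t : 0 < Num.sqrt (qform Sigma (x_ t)).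
Proof.
by have /andP[slo _] := var_range (arm t); rewrite sqrtr_gt0 (lt_le_trans _ slo).
Qed.

Let s2E t : Num.sqrt (qform Sigma (x_ t)) ^+ 2 = qform Sigma (x_ t).
Proof. by have := s2_gt0 t; rewrite sqrtr_gt0 => /ltW; exact: sqr_sqrtr. Qed.

Let s2_le t : Num.sqrt (qform Sigma (x_ t)) ^+ 2 <= S.
Proof. by rewrite s2E; have /andP[] := var_range (arm t). Qed.

(** By [head_error] the unclipped estimate is a polynomial in the noise variables. *)
Lemma measurable_var_hat (x : 'cV[R]_d) :
  measurable_fun setT (fun w => var_hat arm smin2 S (reward arm theta (eta ^~ w)) x).
Proof.
have mq : measurable_fun setT
    (fun w => qform (Sigma_hat arm (reward arm theta (eta ^~ w))) x).
  rewrite (_ : (fun w => _) = (fun w => qform Sigma x +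
      \sum_t (if t \in stage2 Gamma then bform (invmx A2) (phi x) (phi (x_ t)) else 0) *
        ((eta t w - \sum_s (if s \in stage1 Gamma
            then bform (invmx A1) (x_ t) (x_ s) else 0) * eta s w) ^+ 2
         - qform Sigma (x_ t)))).
    apply: measurable_funD => //; apply: measurable_sum => t.
    apply: measurable_funM => //; apply: measurable_funB => //.
    apply: measurable_funX; apply: measurable_funB => //.
    by apply: measurable_sum => s; exact: measurable_funM.
  apply/funext => w; rewrite -[LHS](subrK (qform Sigma x)) [LHS]addrC.
  rewrite head_error //; congr (_ + _); rewrite big_mkcond; apply: eq_bigr => t _.
  by case: ifP => _; rewrite ?mul0r // dot_theta_error.
by apply: measurable_minr => //; exact: measurable_maxr.
Qed.

(** The union bound has one event per arm for the [b t], which depend on [t] only through its arm,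
    [d] events for the [g j], [d] for the [h j] and one for the square term, each of probability at
    most [2 * expR (- l)]. *)
Lemma head_concentration (x : X) (C : R) : 24 * S * Num.sqrt (l * v) <= C ->
  ((1 - (#|{: X}| + (d + d) + 1)%:R * (2 * expR (- l)))%:E <=
   P [set w | (`|var_hat arm smin2 S (reward arm theta (eta ^~ w)) (val x)
                - qform Sigma (val x)| <= C)%R]%classic)%E.
Proof.
move=> C_ge.
have [E EA AE] := gram_factor u1.
pose a t := bform (invmx A2) (phi (val x)) (phi (x_ t)).
pose e t j := (E^T *m x_ t) j 0.
have a_le t : `|a t| <= v by apply: bform_ginv_le => //; exact: A2_le.
have a2_le : \sum_(t in stage2 Gamma) a t ^+ 2 <= v.
  apply: le_trans (A2_le x); rewrite [leRHS](bform_ginv u2).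
  by under [leRHS]eq_bigr do rewrite -expr2.
have bformE y z : bform (invmx A1) y z = \sum_j (E^T *m y) j 0 * (E^T *m z) j 0.
  rewrite AE /bform -mulmxA dot_mulr /dot mxE.
  by apply: eq_bigr => j _; rewrite mxE.
have e2_le t : \sum_j e t j ^+ 2 <= k.
  by apply: le_trans (A1_le (arm t)); rewrite bformE.
(* A diagonal entry of the whitened first-stage Gram matrix; it gives each [g j] variance at most
   [S]. *)
have e2_eq1 j : \sum_(t in stage1 Gamma) e t j ^+ 2 = 1.
  have <- : (E^T *m A1 *m E) j j = 1 by rewrite EA mxE eqxx.
  rewrite /A1 /gram mulmx_sumr mulmx_suml summxE; apply: eq_bigr => t _.
  rewrite mulmxA -mulmxA -[_ *m E]trmxK trmx_mul trmxK mxE big_ord1 [(_^T) 0 j]mxE.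
  by rewrite expr2.
(* Coefficients in the noise of, in order, the first-stage error at an arm, [g j] and [h j]. *)
pose coef (u : X + ('I_d + 'I_d)) t := match u with
  | inl y => if t \in stage1 Gamma then bform (invmx A1) (val y) (x_ t) else 0
  | inr (inl j) => if t \in stage1 Gamma then e t j else 0
  | inr (inr j) => if t \in stage2 Gamma then a t * e t j else 0
  end.
pose W (u : X + ('I_d + 'I_d)) := match u with
  | inl y => S * k
  | inr (inl j) => S
  | inr (inr j) => S * (\sum_(t in stage2 Gamma) (a t * e t j) ^+ 2 + v * k / #|'I_d|%:R)
  end.
have d_gt0 : 0 < #|'I_d|%:R :> R by rewrite card_ord -(pmulr_rgt0 _ k_gt0) kv.
have W_gt0 u : 0 < W u.
  case: u => [y|[j|j]] /=; rewrite ?mulr_gt0 //.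
  rewrite ltr_wpDl ?sumr_ge0 ?divr_gt0 ?mulr_gt0 // => t _; exact: sqr_ge0.
have W_ge u :
    \sum_t coef u t ^+ 2 * Num.sqrt (qform Sigma (x_ t)) ^+ 2 <= W u.
  apply: (@le_trans _ _ (S * \sum_t coef u t ^+ 2)).
    rewrite mulr_sumr; apply: ler_sum => t _.
    by rewrite mulrC ler_wpM2r ?sqr_ge0.
  have ifsq (Q : pred 'I_Gamma) (c : 'I_Gamma -> R) :
      \sum_t (if Q t then c t else 0) ^+ 2 = \sum_(t | Q t) c t ^+ 2.
    by rewrite [RHS]big_mkcond; apply: eq_bigr => t _; case: ifP => //; rewrite expr0n.
  case: u => [y|[j|j]] /=; rewrite ifsq.
  - apply: ler_wpM2l; first exact: ltW.
    apply: le_trans (A1_le y); rewrite [leRHS](bform_ginv u1).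
    by under [leRHS]eq_bigr do rewrite -expr2.
  - by rewrite e2_eq1 mulr1.
  - apply: ler_wpM2l; first exact: ltW.
    by rewrite lerDl divr_ge0 ?mulr_ge0 // ltW.
pose aa t := if t \in stage2 Gamma then a t else 0.
pose Z (u : X + ('I_d + 'I_d) + unit) w := match u with
  | inl u => \sum_t coef u t * eta t w
  | inr _ => \sum_t aa t * (eta t w ^+ 2 - Num.sqrt (qform Sigma (x_ t)) ^+ 2)
  end.
pose r (u : X + ('I_d + 'I_d) + unit) := match u with
  | inl u => Num.sqrt (2 * W u * l)
  | inr _ => 5 * S * Num.sqrt (l * v)
  end.
have mZ u : measurable_fun setT (Z u).
  case: u => [u|[]] /=; apply: measurable_sum => t; first exact: measurable_funM.
  apply: measurable_funM => //; apply: measurable_funB => //.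
  exact: measurable_funX.
rewrite (_ : (#|{: X}| + (d + d) + 1)%N = #|{: X + ('I_d + 'I_d) + unit}|); last first.
  by rewrite !card_sum !card_ord card_unit.
apply: (@union_bound _ _ _ P _ (fun u => [set w | (r u <= `|Z u w|)%R]%classic)).
- move=> u; rewrite -[X in measurable X]setTI.
  by apply: measurable_fun_le => //; exact: measurableT_comp.
- rewrite -[X in measurable X]setTI; apply: measurable_fun_le => //.
  apply: measurableT_comp => //; apply: measurable_funB => //.
  exact: measurable_var_hat.
- case=> [u|[]] /=.
    exact: (linear_tail eta_indep s2_gt0 eta_normal).
  apply: (quadratic_tail eta_indep s2_gt0 eta_normal) => //.
  + apply: le_trans a2_le; rewrite [leRHS]big_mkcond; apply: ler_sum => t _.
    by rewrite /aa; case: ifP => //; rewrite expr0n.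
  + by move=> t; rewrite /aa; case: ifP => _; rewrite ?normr0 // ltW.
move=> w Zw /=; apply: le_trans C_ge.
have Zlt u : `|Z u w| <= r u by rewrite leNgt; apply/negP => /ltW; exact: Zw.
apply: le_trans (clip_dist _ (var_range x)) _.
rewrite head_error //.
have ifsum (Q : pred 'I_Gamma) (c y : 'I_Gamma -> R) :
    \sum_t (if Q t then c t else 0) * y t = \sum_(t | Q t) c t * y t.
  by rewrite [RHS]big_mkcond; apply: eq_bigr => t _; case: ifP => //; rewrite mul0r.
pose g j := \sum_(t in stage1 Gamma) e t j * eta t w.
apply: (@error_le R _ _ _ a _ _ _ e g S v k l) => //.
- by rewrite card_ord.
- move=> t; rewrite dot_theta_error ifsum /g.
  under [RHS]eq_bigr do rewrite mulr_sumr.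
  rewrite exchange_big /=; apply: eq_bigr => s _.
  by rewrite bformE mulr_suml; apply: eq_bigr => j _; rewrite mulrA.
- have := Zlt (inr tt); rewrite /= /aa ifsum.
  congr (`|_| <= _); apply: eq_bigr => t _.
  by rewrite s2E.
- by move=> t; have := Zlt (inl (inl (arm t))); rewrite /= -dot_theta_error.
- by move=> j; have := Zlt (inl (inr (inl j))); rewrite /= ifsum.
- by move=> j; have := Zlt (inl (inr (inr j))); rewrite /= ifsum.
Qed.

End HeadConcentration.

(** * Choice of constants and conclusion *)

Lemma ln16_bound (R : realType) (y : R) : 2 <= y -> 0 < ln y /\ ln (16 * y) <= 5 * ln y.
Proof.
move=> y2; have y0 : 0 < y by lra.
have l2 : 0 < ln (2 : R) by rewrite ln_gt0 //; lra.
have l2y : ln 2 <= ln y by rewrite ler_ln ?posrE.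
split; first lra.
rewrite lnM ?posrE // (_ : 16 = 2 ^+ 4) ?lnXn //; last by rewrite -natrX.
rewrite -[ln 2 *+ 4]mulr_natl; lra.
Qed.

(** Dimension zero has a single vector. Positivity of [d] then turns [d ^ 2 <= Gamma] into
    positivity of the budget. *)
Lemma dim_gt0_of_card (R : realType) d (X : {fset 'cV[R]_d}) :
  (1 < #|` X|)%N -> (0 < d)%N.
Proof.
case: d X => // X; rewrite ltnNge => /negP[].
have : (X `<=` [fset (0 : 'cV[R]_0)])%fset.
  by apply/fsubsetP => y _; rewrite inE; apply/eqP/matrixP => -[].
by move=> /fsubset_leq_card; rewrite cardfs1.
Qed.

Theorem theorem3p1 (R : realType) :
  exists c : R, 0 < c /\
  forall smax2 : R, 0 < smax2 ->
  exists K : R, 0 < K /\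
  forall (d : nat) (X : {fset 'cV[R]_d}),
  (1 < #|` X|)%N ->
  (<<X>> = fullv)%VS ->
  (<<[seq phi x | x <- X]>> = fullv)%VS ->
  forall (theta : 'cV[R]_d) (Sigma : 'M[R]_d) (smin2 : R),
  psd Sigma ->
  0 < smin2 ->
  (forall x : 'cV[R]_d, x \in X -> smin2 <= qform Sigma x <= smax2) ->
  forall (eps delta : R) (Gamma : nat) (arm : 'I_Gamma -> X),
  0 < eps <= 3^-1 ->
  0 < delta < 1 ->
  ~~ odd Gamma ->
  c * Num.max (smax2 * ln (#|` X|%:R / delta) * d%:R ^+ 2) (d%:R ^+ 2)
    <= Gamma%:R ->
  head_pulls arm eps ->
  forall (disp : measure_display) (Omega : measurableType disp)
    (P : probability Omega R) (eta : 'I_Gamma -> {RV P >-> R}),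
  (forall (t : 'I_Gamma) (B : set R), measurable B ->
     distribution P (eta t) B =
     normal_prob 0 (Num.sqrt (qform Sigma (val (arm t)))) B) ->
  mutually_independent eta ->
  forall x : 'cV[R]_d, x \in X ->
  let var_est w := var_hat arm smin2 smax2 (reward arm theta (eta ^~ w)) x in
  let C_Gamma_delta :=
    K * Num.sqrt (ln (#|` X|%:R / delta) * smax2 * d%:R ^+ 2 / Gamma%:R) in
  ((1 - delta / 2)%:E <=
   P [set w | (`|var_est w - qform Sigma x| <= C_Gamma_delta)%R]%classic)%E.
Proof.
(* [60 = 5 * 12]: the 5 comes from [l <= 5 * L] and the 12 from [v]. The error scales with [S], so
   one [Num.sqrt S] goes into the constant beside the one in the rate. *)
exists 1; split=> // S S0; exists (24 * Num.sqrt (60 * S)).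
split; first by rewrite mulr_gt0 // sqrtr_gt0 mulr_gt0.
move=> d X X2 Xspan phispan theta Sigma smin2 [Sigma_sym _] smin0 var_range.
move=> eps delta Gamma arm eps_range /andP[delta0 delta1] Gamma_even Gamma_ge.
move=> [lam1 [lam2 [opt1 round1 opt2 round2]]] disp Omega P eta eta_normal indep.
move=> x xX; cbv zeta; set C := 24 * _ * _.
have X2R : (2 : R) <= #|` X|%:R by rewrite ler_nat.
(* With the 16, each event has probability at most [delta / (8 * #|X|)]; as [d <= #|X|] there are at
   most [4 * #|X|] events, for a total of [delta / 2]. *)
pose L : R := ln (#|` X|%:R / delta); pose l := ln (16 * (#|` X|%:R / delta)).
have [L0 lL] : 0 < L /\ l <= 5 * L.
  by apply: ln16_bound; rewrite ler_pdivlMr //; nra.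
have q0 : 0 < 16 * (#|` X|%:R / delta) by rewrite mulr_gt0 // divr_gt0 //; lra.
have expl : expR (- l) = delta / (16 * #|` X|%:R).
  by rewrite expRN lnK ?posrE //; field; rewrite !gt_eqF //; lra.
have l0 : 0 < l.
  apply: lt_le_trans L0 _; rewrite ler_ln ?posrE //; first last.
    by rewrite divr_gt0 //; lra.
  by rewrite ler_peMl ?ltW //; lra.
have d0 := dim_gt0_of_card X2.
have d0R : (1 : R) <= d%:R by rewrite ler1n.
have d2_le : (d%:R ^+ 2 : R) <= Gamma%:R.
  by apply: le_trans Gamma_ge; rewrite mul1r le_max lexx orbT.
have Gamma0 : (1 : R) <= Gamma%:R by apply: le_trans d2_le; rewrite expr2; nra.
have GammaE : (Gamma%:R : R) = 2 * (Gamma./2)%:R.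
  by rewrite -{1}(even_halfK Gamma_even) -muln2 natrM mulrC.
have N0 : (0 : R) < (Gamma./2)%:R by lra.
have N0n : (0 < Gamma./2)%N by rewrite -(ltr0n R).
(* The bounds [6 * n / N] of [rounded_optimal_design] at [N = Gamma / 2], with [n = d] for [k] and
   [n = vech_dim d <= d ^ 2] for [v]. *)
pose k : R := 12 * d%:R / Gamma%:R; pose v : R := 12 * d%:R ^+ 2 / Gamma%:R.
have k0 : 0 < k by rewrite divr_gt0 ?mulr_gt0 //; lra.
have v0 : 0 < v by rewrite divr_gt0 ?mulr_gt0 ?exprn_gt0 //; lra.
have lv0 : 0 <= l * v by rewrite mulr_ge0 ?ltW.
have CE : C = 24 * S * Num.sqrt (5 * L * v).
  rewrite /C -/L -[LHS]mulrA -sqrtrM; last by rewrite mulr_ge0 // ltW.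
  rewrite -[RHS]mulrA; congr (24 * _).
  rewrite -[S in RHS](gtr0_norm S0) -sqrtr_sqr -sqrtrM ?sqr_ge0 //.
  by congr Num.sqrt; rewrite /v; field; rewrite gt_eqF //; lra.
have C_ge : 24 * S * Num.sqrt (l * v) <= C.
  rewrite CE; apply: ler_wpM2l; first by rewrite mulr_ge0 // ltW.
  by rewrite ler_wsqrtr // ler_wpM2r // ltW.
(* If [1 < l * v] then [C >= 24 * S], whereas clipping keeps the error at most [S]. *)
have [lv1|lv1] := leP (l * v) 1; last first.
  rewrite (_ : [set w | _]%classic = setT); first by rewrite probability_setT lee_fin; lra.
  apply/seteqP; split=> // w _ /=; apply: le_trans (clip_dist_le _ _ (var_range x xX)) _.
    exact: ltW.
  apply: le_trans C_ge; have : 1 <= Num.sqrt (l * v).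
    by rewrite -[leLHS]sqrtr1 ler_wsqrtr // ltW.
  by nra.
have XE : #|{: X}| = #|` X| by rewrite cardfE.
have X0n : (0 < #|{: X}|)%N by rewrite XE ltnW.
have span1 z : (forall y : X, dot (val y) z = 0) -> z = 0.
  by move=> h; apply: (dot_span_eq0 Xspan) => y yX; exact: (h (FSetSub yX)).
have span2 z : (forall y : X, dot (phi (val y)) z = 0) -> z = 0.
  move=> h; apply: (dot_span_eq0 phispan) => _ /mapP[y yX ->].
  exact: (h (FSetSub yX)).
have leX1 : (d <= #|{: X}|)%N by rewrite XE; exact: size_span_col Xspan.
have leX2 : (vech_dim d <= #|{: X}|)%N.
  by rewrite XE; have := size_span_col phispan; rewrite size_map.
have [] := rounded_optimal_design span1 X0n leX1 eps_range N0n opt1 round1.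
have [] := rounded_optimal_design span2 X0n leX2 eps_range N0n opt2 round2.
rewrite !info_mx_count => u2 A2_le u1 A1_le.
have kE : k = 6 * d%:R / (Gamma./2)%:R.
  by rewrite /k GammaE; field; rewrite gt_eqF.
have vE : v = 6 * d%:R ^+ 2 / (Gamma./2)%:R.
  by rewrite /v GammaE; field; rewrite gt_eqF.
have A2_le_v (y : X) : bform (invmx (gram (mem (stage2 Gamma))
    (@phi d R \o (fun t => val (arm t))))) (phi (val y)) (phi (val y)) <= v.
  apply: le_trans (A2_le y) _; rewrite vE.
  apply: ler_wpM2r; first by rewrite invr_ge0 ltW.
  by apply: ler_wpM2l => //; rewrite -natrX ler_nat vech_dim_le.
have kv : k * d%:R = v by rewrite /k /v; field; rewrite gt_eqF //; lra.
have nk : \sum_(t in stage2 Gamma) k ^+ 2 <= 12 * v.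
  rewrite sumr_const -[_ *+ #|_|]mulr_natl; apply: (@le_trans _ _ (Gamma%:R * k ^+ 2)).
    by rewrite ler_wpM2r ?sqr_ge0 // ler_nat -[leqRHS]card_ord max_card.
  rewrite le_eqVlt; apply/orP; left; apply/eqP.
  by rewrite /k /v; field; rewrite gt_eqF //; lra.
rewrite -kE in A1_le.
have := head_concentration theta Sigma_sym u1 u2 indep eta_normal S0 v0 k0 l0 smin0
  (fun y : X => var_range _ (valP y)) A1_le A2_le_v kv nk lv1 (FSetSub xX) C_ge.
apply: le_trans; rewrite lee_fin lerD2l lerN2 expl XE.
have X0 : (0 : R) < #|` X|%:R by lra.
rewrite [leLHS](_ : _ = (#|` X| + (d + d) + 1)%:R / #|` X|%:R * (delta / 8)); last first.
  by field; rewrite gt_eqF.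
rewrite (_ : delta / 2 = 4 * (delta / 8)); last by field.
apply: ler_wpM2r; first by rewrite divr_ge0 // ltW.
rewrite ler_pdivrMr // !natrD.
have : (d%:R : R) <= #|` X|%:R by rewrite ler_nat -XE.
lra.
Qed.
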